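(* Let $d=2j+1$ be a positive odd integer ($j\ge 0$ an integer) and let $\sigma=\begin{pmatrix} a & b\\ b & c\end{pmatrix}$ be a real symmetric positive definite matrix. Then the discrete Wigner function $\mathbf{W}_{\mathbf{g}_\sigma}$ of $\mathbf{g}_\sigma$ is an algebraic sum of 16 products of Gaussian like functions, namely, for all integers $n_1,n_2,k_1,k_2$, $$\begin{aligned} \mathbf{W}_{\mathbf{g}_\sigma}(n_1,n_2,k_1,k_2) &=\tfrac{1}{2d\sqrt{\det\sigma}}\,\mathbf{g}_{2\sigma}(n_1,n_2)\left[\mathbf{g}_{2\sigma^{-1}}(k_1,k_2)+\mathbf{g}^{+0}_{2\sigma^{-1}}(k_1,k_2)+\mathbf{g}^{0+}_{2\sigma^{-1}}(k_1,k_2)+\mathbf{g}^{++}_{2\sigma^{-1}}(k_1,k_2)\right]\\ &+\tfrac{1}{2d\sqrt{\det\sigma}}\,\mathbf{g}^{+0}_{2\sigma}(n_1,n_2)\left[\mathbf{g}_{2\sigma^{-1}}(k_1,k_2)-\mathbf{g}^{+0}_{2\sigma^{-1}}(k_1,k_2)+\mathbf{g}^{0+}_{2\sigma^{-1}}(k_1,k_2)-\mathbf{g}^{++}_{2\sigma^{-1}}(k_1,k_2)\right]\\ &+\tfrac{1}{2d\sqrt{\det\sigma}}\,\mathbf{g}^{0+}_{2\sigma}(n_1,n_2)\left[\mathbf{g}_{2\sigma^{-1}}(k_1,k_2)+\mathbf{g}^{+0}_{2\sigma^{-1}}(k_1,k_2)-\mathbf{g}^{0+}_{2\sigma^{-1}}(k_1,k_2)-\mathbf{g}^{++}_{2\sigma^{-1}}(k_1,k_2)\right]\\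 &+\tfrac{1}{2d\sqrt{\det\sigma}}\,\mathbf{g}^{++}_{2\sigma}(n_1,n_2)\left[\mathbf{g}_{2\sigma^{-1}}(k_1,k_2)-\mathbf{g}^{+0}_{2\sigma^{-1}}(k_1,k_2)-\mathbf{g}^{0+}_{2\sigma^{-1}}(k_1,k_2)+\mathbf{g}^{++}_{2\sigma^{-1}}(k_1,k_2)\right]. \end{aligned}$$
   Context: Fix a positive odd integer $d=2j+1$. For a real symmetric positive definite $2\times2$ matrix $\sigma$ write $Q_\sigma(x_1,x_2)=(x_1,\,x_2)\,\sigma\begin{pmatrix} x_1 \\ x_2 \end{pmatrix}$, and define, for $(n_1,n_2)\in\mathbb{Z}\times\mathbb{Z}$, $$\mathbf{g}_\sigma(n_1,n_2)=\sum_{\alpha_1,\alpha_2\in\mathbb{Z}}e^{-\frac{\pi}{d}Q_\sigma(n_1+\alpha_1d,\;n_2+\alpha_2d)},$$ $$\mathbf{g}^{+0}_\sigma(n_1,n_2)=\sum_{\alpha_1,\alpha_2\in\mathbb{Z}}e^{-\frac{\pi}{d}Q_\sigma(n_1+(\alpha_1+\frac12)d,\;n_2+\alpha_2d)},$$ $$\mathbf{g}^{0+}_\sigma(n_1,n_2)=\sum_{\alpha_1,\alpha_2\in\mathbb{Z}}e^{-\frac{\pi}{d}Q_\sigma(n_1+\alpha_1d,\;n_2+(\alpha_2+\frac12)d)},$$ $$\mathbf{g}^{++}_\sigma(n_1,n_2)=\sum_{\alpha_1,\alpha_2\in\mathbb{Z}}e^{-\frac{\pi}{d}Q_\sigma(n_1+(\alpha_1+\frac12)d,\;n_2+(\alpha_2+\frac12)d)}.$$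 The subscripts $2\sigma$ and $2\sigma^{-1}$ denote the same functions with $\sigma$ replaced by $2\sigma$ and by $2(\sigma^{-1})$. For $\psi:\mathbb{Z}\times\mathbb{Z}\to\mathbb{C}$ that is $d$-periodic in each variable, the discrete Wigner function is $$\mathbf{W}_\psi(n_1,n_2,k_1,k_2)=\frac1{d^2}\sum_{m_1=-j}^{j}\sum_{m_2=-j}^{j}e^{-\frac{4\pi \mathrm{i}}{d}(k_1m_1+k_2m_2)}\,\overline{\psi(n_1-m_1,n_2-m_2)}\,\psi(n_1+m_1,n_2+m_2).$$ *)

(* Defs.v *)
From HB Require Import structures.
From mathcomp Require Import all_boot all_order all_algebra.
From mathcomp Require Import complex.
From mathcomp Require Import all_classical all_reals all_analysis.

Set Implicit Arguments.
Unset Strict Implicit.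
Unset Printing Implicit Defensive.

Import Order.TTheory GRing.Theory Num.Theory.

Local Open Scope ring_scope.
Local Open Scope complex_scope.

Definition col2 (R : realType) (x1 x2 : R) : 'cV[R]_2 :=
  \col_(i < 2) (if i == 0 then x1 else x2).

Definition quad_form (R : realType) (s : 'M[R]_2) (x1 x2 : R) : R :=
  ((col2 x1 x2)^T *m s *m col2 x1 x2) 0 0.

Definition posdef (R : realType) (s : 'M[R]_2) : Prop :=
  forall x : 'cV[R]_2, x != 0 -> 0 < (x^T *m s *m x) 0 0.

(* The terms are positive, so the unordered sum over Z x Z is [esum]; it is
   finite for positive definite [s] and [d > 0], the only case of interest
   ([fine] would send an infinite sum to 0). *)
Definition gauss_shift (R : realType) (h1 h2 : R) (d : nat) (s : 'M[R]_2)
    (n1 n2 : int) : R :=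
  fine (\esum_(a in [set: int * int]%classic)
    (expR (- (pi / d%:R) *
      quad_form s (n1%:~R + (a.1%:~R + h1) * d%:R)
                  (n2%:~R + (a.2%:~R + h2) * d%:R)))%:E).

Definition gauss (R : realType) := @gauss_shift R 0 0.
Definition gauss_p0 (R : realType) := @gauss_shift R 2^-1 0.
Definition gauss_0p (R : realType) := @gauss_shift R 0 2^-1.
Definition gauss_pp (R : realType) := @gauss_shift R 2^-1 2^-1.

Definition expi (R : realType) (t : R) : R[i] := cos t +i* sin t.

Definition sum_sym (V : nmodType) (j : nat) (F : int -> V) : V :=
  \sum_(i < (2 * j + 1)%N) F ((i : nat)%:Z - j%:Z).

(* Meant for [d = 2 * j + 1] and [psi] d-periodic in each variable. *)
Definition wigner (R : realType) (d j : nat) (psi : int -> int -> R[i])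
    (n1 n2 k1 k2 : int) : R[i] :=
  (d%:R ^+ 2)^-1 *
  sum_sym j (fun m1 => sum_sym j (fun m2 =>
    expi (- (4 * pi / d%:R) * (k1 * m1 + k2 * m2)%:~R) *
    (psi (n1 - m1) (n2 - m2))^* * psi (n1 + m1) (n2 + m2))).

(* Main.v *)
(** Periodizing and using the parallelogram identity, [g(n - m) g(n + m)] becomes a
    sum over the four parity classes [e] of [g^e_{2s}(n) g^e_{2s}(m)]; summing the
    second factor against the character in [m] unfolds to a Gaussian sum over
    [Z x Z], and Poisson summation turns it into the dual Gaussians [g^f_{2/s}(k)]
    with the signs [(-1)^(e.f)].

    The Poisson formula in one variable is obtained by Polya's argument: expand
    [(2 cos x)^(2m)] by the binomial theorem, sum over the [l]-th roots of unity, and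
    let [l] tend to infinity with [m / l^2 -> A / pi]; powers of cosines and binomial
    coefficients both become Gaussians, with dominated convergence.  All sums are
    real: the cosine carries a free phase [theta], and [theta = 0] or [- pi / 2]
    gives the real or imaginary part. *)
Require Import Defs.
From HB Require Import structures.
From mathcomp Require Import all_boot all_order all_algebra.
From mathcomp Require Import complex.
From mathcomp Require Import all_classical all_reals all_analysis.
From mathcomp Require Import ring lra zify.

Set Implicit Arguments.
Unset Strict Implicit.
Unset Printing Implicit Defensive.

Import Order.TTheory GRing.Theory Num.Theory.
Import numFieldTopology.Exports numFieldNormedType.Exports.

Local Open Scope ring_scope.

(** * Absolutely convergent unordered sums *)

Section UnorderedSums.
Context {R : realType}.
Implicit Types (T U : choiceType) (c : R).

(** The one-variable formula keeps a real shift [s] and a real frequency [u] because the step to two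
    variables uses both: completing the square moves the centre of one Gaussian by a multiple of the
    other variable, and the transformed phase then moves the next frequency in the same way.

    In Polya's argument the ranges of summation grow with [l]. One and the same number is therefore
    presented as two families over all of Z, cosines cut off to a symmetric window and binomial
    coefficients that vanish far out, each with a summable majorant independent of [l].

    The half shifts on the dual side come from the factor 4 pi in the character. Its frequency is
    2k/d, and z + 2k/d = (2/d)(k + z d/2), so the parity f of the dual lattice point z decides
    whether k is moved by d/2. A half shift e of the original Gaussian becomes the phase pi d e z,
    which is the sign (-1)^(e f) because d is odd. *)

Definition nnsum T (p : T -> R) (P : R) : Prop :=
  (forall t, 0 <= p t) /\ (\esum_(t in [set: T]%classic) (p t)%:E = P%:E)%E.

(* An absolutely convergent unordered real sum, presented as a difference of two
   nonnegative families with finite [esum]. *)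
Definition is_sum T (f : T -> R) (S : R) : Prop :=
  exists p q P Q, [/\ nnsum p P, nnsum q Q, forall t, f t = p t - q t & S = P - Q].

Lemma nnsumD T (p q : T -> R) P Q :
  nnsum p P -> nnsum q Q -> nnsum (fun t => p t + q t) (P + Q).
Proof.
move=> [p0 pP] [q0 qQ]; split=> [t|]; first exact: addr_ge0.
rewrite EFinD -pP -qQ -esumD//; try by move=> t _; rewrite lee_fin.
Qed.

Lemma nnsum_inj T (p : T -> R) P Q : nnsum p P -> nnsum p Q -> P = Q.
Proof. by move=> [_ pP] [_]; rewrite pP => -[]. Qed.

Lemma eq_nnsum T (p q : T -> R) P : p =1 q -> nnsum p P -> nnsum q P.
Proof. by move=> /funext ->. Qed.

Lemma nnsum_ge0 T (p : T -> R) P : nnsum p P -> 0 <= P.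
Proof.
by move=> [p0 pP]; rewrite -lee_fin -pP; apply: esum_ge0 => t _; rewrite lee_fin.
Qed.

Lemma nnsum_le T (p g : T -> R) G : nnsum g G -> (forall t, 0 <= p t <= g t) ->
  exists P, nnsum p P.
Proof.
move=> [g0 gG] pg; exists (fine (\esum_(t in [set: T]%classic) (p t)%:E)%E).
split=> [t|]; first by case/andP: (pg t).
rewrite fineK// ge0_fin_numE; last first.
  by apply: esum_ge0 => t _; rewrite lee_fin; case/andP: (pg t).
apply: (@le_lt_trans _ _ G%:E); last exact: ltry.
by rewrite -gG; apply: le_esum => t _; rewrite lee_fin; case/andP: (pg t).
Qed.

(** Finite partial sums give this inequality directly; the reverse one follows in [esumZ] by
    applying it with the factor [c^-1]. *)
Lemma esumZ_le T (p : T -> \bar R) c : 0 <= c -> (forall t, (0 <= p t)%E) ->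
  (\esum_(t in [set: T]%classic) (c%:E * p t) <=
   c%:E * \esum_(t in [set: T]%classic) p t)%E.
Proof.
move=> c0 p0; apply: ge_ereal_sup => _ [X [finX XT]] <-.
rewrite -ge0_mule_fsumr//; apply: lee_pmul => //.
- by apply: fsume_ge0.
- by apply: esum_ge; exists X.
Qed.

Lemma esumZ T (p : T -> R) c : 0 <= c -> (forall t, 0 <= p t) ->
  (\esum_(t in [set: T]%classic) (c * p t)%:E =
   c%:E * \esum_(t in [set: T]%classic) (p t)%:E)%E.
Proof.
rewrite le_eqVlt => /orP[/eqP <- p0|c0 p0].
  by rewrite mul0e esum1// => t _; rewrite mul0r.
have pE t : (0 <= (p t)%:E)%E by rewrite lee_fin.
apply/eqP; rewrite eq_le; apply/andP; split.
  by have := esumZ_le (ltW c0) pE.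
have ci : 0 <= c^-1 by rewrite invr_ge0 ltW.
have cpE t : (0 <= (c * p t)%:E)%E by rewrite lee_fin mulr_ge0// ltW.
have := esumZ_le ci cpE.
have -> : (\esum_(t in [set: T]%classic) (c^-1%:E * (c * p t)%:E) =
  \esum_(t in [set: T]%classic) (p t)%:E)%E.
  by apply: eq_esum => t _; rewrite -EFinM mulrA mulVf ?mul1r// gt_eqF.
move=> h; apply: (le_trans (lee_pmul _ _ (lexx c%:E) h)) => //.
- by rewrite lee_fin ltW.
- exact: esum_ge0.
- by rewrite muleA -EFinM mulfV ?mul1e// gt_eqF.
Qed.

Lemma nnsumZ T (p : T -> R) P c : 0 <= c -> nnsum p P ->
  nnsum (fun t => c * p t) (c * P).
Proof.
move=> c0 [p0 pP]; split=> [t|]; first exact: mulr_ge0.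
by rewrite esumZ// pP.
Qed.

Lemma nnsum_reindex T U (e : U -> T) (p : T -> R) P : bijective e ->
  nnsum p P -> nnsum (p \o e) P.
Proof.
move=> be [p0 pP]; split=> [u|]; first exact: p0.
by rewrite -pP; apply/esym; apply: reindex_esum; rewrite setTT_bijective.
Qed.

Lemma nnsum_prod T U (p : T -> R) (q : U -> R) P Q : nnsum p P -> nnsum q Q ->
  nnsum (fun x : T * U => p x.1 * q x.2) (P * Q).
Proof.
move=> [p0 pP] [q0 qQ]; split=> [x|]; first exact: mulr_ge0.
have -> : [set: T * U]%classic = ([set: T] `*`` (fun=> [set: U]))%classic.
  by apply/seteqP; split.
rewrite -(@esum_esum _ _ _ _ _ (fun t u => (p t * q u)%:E)); last first.
  by move=> t u _ _; rewrite lee_fin mulr_ge0.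
have Q0 : 0 <= Q by apply: (@nnsum_ge0 _ q); split.
transitivity (\esum_(t in [set: T]%classic) (Q * p t)%:E)%E.
  by apply: eq_esum => t _; rewrite (esumZ (p0 t) q0) qQ -EFinM mulrC.
by rewrite (esumZ Q0 p0) pP -EFinM mulrC.
Qed.

(** Each inner sum is a one-point partial sum of the outer family, hence at most [P]; so it is
    finite and [fine] loses nothing. *)
Lemma nnsum_fubini T U (p : T * U -> R) P : nnsum p P ->
  exists2 h, (forall t, nnsum (fun u => p (t, u)) (h t)) & nnsum h P.
Proof.
move=> [p0 pP].
have sT : [set: T * U]%classic = ([set: T] `*`` (fun=> [set: U]))%classic.
  by apply/seteqP; split.
pose H t : \bar R := (\esum_(u in [set: U]%classic) (p (t, u))%:E)%E.
have H0 t : (0 <= H t)%E by apply: esum_ge0 => u _; rewrite lee_fin.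
have HP : (\esum_(t in [set: T]%classic) H t = P%:E)%E.
  rewrite -pP sT /H (@esum_esum _ _ _ _ _ (fun t u => (p (t, u))%:E)); last first.
    by move=> t u _ _; rewrite lee_fin.
  by apply: eq_esum => -[].
have Hfin t : H t \is a fin_num.
  rewrite ge0_fin_numE//; apply: (@le_lt_trans _ _ P%:E); last exact: ltry.
  rewrite -HP; apply: esum_ge; exists [set t]%classic; last by rewrite fsbig_set1.
  by split.
exists (fun t => fine (H t)) => [t|].
  by split=> [u|]; [exact: p0|rewrite fineK].
split=> [t|]; first exact: fine_ge0.
by rewrite -HP; apply: eq_esum => t _; rewrite fineK.
Qed.

Lemma nnsum_delta T (x : T) c : 0 <= c -> nnsum (fun t => if t == x then c else 0) c.
Proof.
move=> c0; split=> [t|]; first by case: ifP.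
rewrite -[RHS](@esum_set1 _ _ x (fun=> c%:E)) ?lee_fin//.
rewrite [RHS]esum_mkcond; apply: eq_esum => t _.
have [->|tx] := eqVneq t x; first by rewrite mem_set.
by rewrite memNset//= => txx; rewrite txx eqxx in tx.
Qed.

Lemma nnsum_approx T (p : T -> R) P (e : R) : nnsum p P -> 0 < e ->
  exists2 s : seq T, uniq s & P - e <= \sum_(t <- s) p t.
Proof.
move=> [p0 pP] e0.
have fin : (\esum_(t in [set: T]%classic) (p t)%:E)%E \is a fin_num by rewrite pP.
have [x [X [finX XT] <-]] := ub_ereal_sup_adherent e0 fin.
rewrite -/(esum _ _) pP fsbig_finite//= sumEFin => h; 
exists (finmap.enum_fset (fset_set X)); first exact: finmap.fset_uniq.
by rewrite -lee_fin EFinB (le_trans (ltW h)).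
Qed.

Lemma is_sum_nnsum T (p : T -> R) P : nnsum p P -> is_sum p P.
Proof.
move=> pP; exists p, (fun=> 0), P, 0; split=> //; try by move=> *; rewrite subr0.
by split=> //; rewrite esum1.
Qed.

Lemma eq_is_sum T (f g : T -> R) S : f =1 g -> is_sum f S -> is_sum g S.
Proof. by move=> /funext ->. Qed.

(** Two decompositions p - q = p' - q' give the same nonnegative family p + q' = p' + q, whose sum
    is unique. *)
Lemma is_sum_inj T (f : T -> R) S S' : is_sum f S -> is_sum f S' -> S = S'.
Proof.
move=> [p [q [P [Q [pP qQ fpq ->]]]]] [p' [q' [P' [Q' [pP' qQ' fpq' ->]]]]].
have : P + Q' = P' + Q.
  apply: nnsum_inj (nnsumD pP qQ') _; apply: eq_nnsum (nnsumD pP' qQ) => t.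
  by have := fpq t; rewrite fpq'; lra.
lra.
Qed.

Lemma is_sumD T (f g : T -> R) S S' :
  is_sum f S -> is_sum g S' -> is_sum (fun t => f t + g t) (S + S').
Proof.
move=> [p [q [P [Q [pP qQ fpq ->]]]]] [p' [q' [P' [Q' [pP' qQ' fpq' ->]]]]].
exists (fun t => p t + p' t), (fun t => q t + q' t), (P + P'), (Q + Q').
split; [exact: nnsumD|exact: nnsumD| |by lra].
by move=> t; rewrite fpq fpq'; lra.
Qed.

Lemma is_sumN T (f : T -> R) S : is_sum f S -> is_sum (fun t => - f t) (- S).
Proof.
move=> [p [q [P [Q [pP qQ fpq ->]]]]]; exists q, p, Q, P; split => //; last by lra.
by move=> t; rewrite fpq; lra.
Qed.

Lemma is_sumZ T (f : T -> R) S c : is_sum f S -> is_sum (fun t => c * f t) (c * S).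
Proof.
wlog c0 : c / 0 <= c => [hw fS|].
  have [/hw|/ltW c0] := lerP 0 c; first exact.
  have := is_sumN (hw (- c) _ fS); rewrite oppr_ge0 => /(_ c0).
  rewrite mulNr opprK; apply: eq_is_sum => t; lra.
move=> [p [q [P [Q [pP qQ fpq ->]]]]].
exists (fun t => c * p t), (fun t => c * q t), (c * P), (c * Q).
split; [exact: nnsumZ|exact: nnsumZ| |by lra].
by move=> t; rewrite fpq; lra.
Qed.

Lemma is_sumB T (f g : T -> R) S S' :
  is_sum f S -> is_sum g S' -> is_sum (fun t => f t - g t) (S - S').
Proof. by move=> fS gS; exact: is_sumD fS (is_sumN gS). Qed.

Lemma is_sum0 T : is_sum (fun _ : T => 0) 0.
Proof. by apply: is_sum_nnsum; split=> //; rewrite esum1. Qed.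

Lemma is_sum_big T (I : eqType) (r : seq I) (F : I -> T -> R) (S : I -> R) :
  (forall i, i \in r -> is_sum (F i) (S i)) ->
  is_sum (fun t => \sum_(i <- r) F i t) (\sum_(i <- r) S i).
Proof.
elim: r => [_|i r ih h].
  by rewrite big_nil; apply: eq_is_sum (is_sum0 T) => t; rewrite big_nil.
rewrite big_cons; apply: eq_is_sum; last first.
  apply: is_sumD (h i _) (ih _); first by rewrite inE eqxx.
  by move=> k kr; apply: h; rewrite inE kr orbT.
by move=> t; rewrite big_cons.
Qed.

Lemma is_sum_delta T (x : T) c : is_sum (fun t => if t == x then c else 0) c.
Proof.
apply: eq_is_sum; last first.
  have := is_sumZ c (is_sum_nnsum (nnsum_delta x (@ler01 R))).
  by rewrite mulr1; apply.
by move=> t; case: ifP; rewrite ?mulr1 ?mulr0.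
Qed.

Lemma is_sum_seq T (s : seq T) (f : T -> R) : uniq s ->
  is_sum (fun t => if t \in s then f t else 0) (\sum_(t <- s) f t).
Proof.
move=> us; apply: eq_is_sum; last first.
  by apply: is_sum_big => x _; exact: (is_sum_delta x (f x)).
move=> t; case: ifP => ts.
  rewrite (bigD1_seq t)//= eqxx big1_seq ?addr0// => x /andP[xt _].
  by rewrite eq_sym (negbTE xt).
rewrite big1_seq// => x /andP[_ xs]; case: eqP => // tx.
by rewrite tx xs in ts.
Qed.

Lemma is_sum_fin (I : finType) (f : I -> R) : is_sum f (\sum_i f i).
Proof.
have := is_sum_seq f (index_enum_uniq I); apply: eq_is_sum => i.
by rewrite mem_index_enum.
Qed.

(** Write f = (g + f) - g, where 0 <= g + f <= 2 g. *)
Lemma is_sum_dom T (f g : T -> R) G : nnsum g G -> (forall t, `|f t| <= g t) ->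
  exists S, is_sum f S.
Proof.
move=> gG fg.
have [P pP] : exists P, nnsum (fun t => g t + f t) P.
  apply: (nnsum_le (nnsumD gG gG)) => t; have := fg t; rewrite ler_norml; lra.
exists (P - G), (fun t => g t + f t), g, P, G; split=> // t; lra.
Qed.

Lemma is_sum_nnsumE T (f : T -> R) S : (forall t, 0 <= f t) -> is_sum f S -> nnsum f S.
Proof.
move=> f0 fS; have [p [q [P [Q [pP qQ fpq SPQ]]]]] := fS.
have [S' fS'] : exists S', nnsum f S'.
  apply: (nnsum_le pP) => t; rewrite f0 fpq; have := qQ.1 t; lra.
by rewrite (is_sum_inj fS (is_sum_nnsum fS')).
Qed.

Lemma is_sum_ge0 T (f : T -> R) S : (forall t, 0 <= f t) -> is_sum f S -> 0 <= S.
Proof. by move=> f0 /(is_sum_nnsumE f0)/nnsum_ge0. Qed.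

Lemma is_sum_reindex T U (e : U -> T) (f : T -> R) S : bijective e ->
  is_sum f S -> is_sum (f \o e) S.
Proof.
move=> be [p [q [P [Q [pP qQ fpq ->]]]]].
exists (p \o e), (q \o e), P, Q; split=> //; try exact: nnsum_reindex.
by move=> u; rewrite /= fpq.
Qed.

Lemma nnsum_pullback T U (e : U -> T) (f : T -> R) S : injective e ->
  (forall t, (forall u, t != e u) -> f t = 0) -> nnsum f S -> nnsum (f \o e) S.
Proof.
move=> ie f0 [fp fS]; split=> [u|]; first exact: fp.
rewrite -(@esum_image _ _ _ _ e (fun t => (f t)%:E)); last by move=> x y _ _ /ie.
rewrite -fS [LHS]esum_mkcond; apply: eq_esum => t _.
case: ifPn => // /negP; rewrite inE => nt; rewrite f0// => u.
by apply/eqP => tu; apply: nt; exists u.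
Qed.

Lemma is_sum_pullback T U (e : U -> T) (f : T -> R) S : injective e ->
  (forall t, (forall u, t != e u) -> f t = 0) -> is_sum f S -> is_sum (f \o e) S.
Proof.
move=> ie f0 [p [q [P [Q [pP qQ fpq ->]]]]].
(* Off the range of [e] only the difference p - q vanishes, not [p] and [q] themselves; both are set
   to 0 at the zeros of [f] before being pulled back. *)
have [P' pP'] : exists P', nnsum (fun t => if f t == 0 then 0 else p t) P'.
  by apply: (nnsum_le pP) => t; have := pP.1 t; case: ifP => _; rewrite ?lexx => ->.
have [Q' qQ'] : exists Q', nnsum (fun t => if f t == 0 then 0 else q t) Q'.
  by apply: (nnsum_le qQ) => t; have := qQ.1 t; case: ifP => _; rewrite ?lexx => ->.
have fE t : f t = (if f t == 0 then 0 else p t) - (if f t == 0 then 0 else q t).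
  by case: eqP => [->|_]; rewrite ?subr0.
have -> : P - Q = P' - Q'.
  apply: (@is_sum_inj _ f); first by exists p, q, P, Q.
  by do 4 eexists; split; [exact: pP'|exact: qQ'|exact: fE|].
do 4 eexists; split.
- by apply: (nnsum_pullback ie _ pP') => t /f0 ->; rewrite eqxx.
- by apply: (nnsum_pullback ie _ qQ') => t /f0 ->; rewrite eqxx.
- by move=> u /=; exact: fE.
- by [].
Qed.

Lemma is_sum_fubini T U (f : T * U -> R) (h : T -> R) S : is_sum f S ->
  (forall t, is_sum (fun u => f (t, u)) (h t)) -> is_sum h S.
Proof.
move=> [p [q [P [Q [pP qQ fpq ->]]]]] fh.
have [hp hpE hpP] := nnsum_fubini pP; have [hq hqE hqQ] := nnsum_fubini qQ.
exists hp, hq, P, Q; split=> // t; apply: is_sum_inj (fh t) _.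
by exists (fun u => p (t, u)), (fun u => q (t, u)), (hp t), (hq t); split.
Qed.

Lemma is_sum_fubini_swap T U (f : T * U -> R) (h : U -> R) S : is_sum f S ->
  (forall u, is_sum (fun t => f (t, u)) (h u)) -> is_sum h S.
Proof.
move=> fS fh; apply: (@is_sum_fubini _ _ (f \o (fun x : U * T => (x.2, x.1)))) => //.
by apply: is_sum_reindex fS; exists (fun x => (x.2, x.1)) => -[].
Qed.

(** This is the form in which a sum over Z x Z or its square is cut into finitely many parity or
    residue classes. *)
Lemma is_sum_finpart (I : finType) T U (e : I * U -> T) (f : T -> R) (h : I -> R) S :
  bijective e -> is_sum f S -> (forall i, is_sum (fun u => f (e (i, u))) (h i)) ->
  S = \sum_i h i.
Proof.
move=> be fS fh; apply: is_sum_inj (is_sum_fin h).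
exact: is_sum_fubini (is_sum_reindex be fS) fh.
Qed.

(** Off [s] both g + f and g - f are nonnegative, so both of their sums are. *)
Lemma is_sum_tail T (f g : T -> R) S G (s : seq T) : uniq s ->
  is_sum f S -> is_sum g G -> (forall t, `|f t| <= g t) ->
  `|S - \sum_(t <- s) f t| <= G - \sum_(t <- s) g t.
Proof.
move=> us fS gG fg.
have fS' := is_sumB fS (is_sum_seq f us); have gG' := is_sumB gG (is_sum_seq g us).
have hD := is_sumD gG' fS'; have hB := is_sumB gG' fS'.
rewrite ler_norml; apply/andP; split.
- suff : 0 <= G - \sum_(t <- s) g t + (S - \sum_(t <- s) f t) by lra.
  apply: is_sum_ge0 hD => t /=; have := fg t; rewrite ler_norml.
  by case: ifP => _; lra.
- suff : 0 <= G - \sum_(t <- s) g t - (S - \sum_(t <- s) f t) by lra.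
  apply: is_sum_ge0 hB => t /=; have := fg t; rewrite ler_norml.
  by case: ifP => _; lra.
Qed.

Lemma cvg_sum_seq T (s : seq T) (F : nat -> T -> R) (f : T -> R) :
  (forall t, (F n t @[n --> \oo] --> f t)%classic) ->
  ((\sum_(t <- s) F n t) @[n --> \oo] --> (\sum_(t <- s) f t : R))%classic.
Proof.
move=> Ff; elim: s => [|t s ih].
  rewrite big_nil; under eq_fun do rewrite big_nil; exact: cvg_cst.
by rewrite big_cons; under eq_fun do rewrite big_cons; exact: cvgD.
Qed.

(** Dominated convergence for sums. A finite [s] carries all of [G] up to e/4, which bounds the
    tails of [f] and of every dominated [F n]; on [s] finitely many pointwise limits contribute
    another e/4. *)
Lemma tannery T (F : nat -> T -> R) (f g : T -> R) (SF : nat -> R) S G :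
  nnsum g G -> (\forall n \near \oo%classic, forall t, `|F n t| <= g t) ->
  (forall t, (F n t @[n --> \oo] --> f t)%classic) ->
  (forall n, is_sum (F n) (SF n)) -> is_sum f S ->
  (SF n @[n --> \oo] --> S)%classic.
Proof.
move=> gG Fg Ff FSF fS.
have fg t : `|f t| <= g t.
  apply: (cvgr_to_le (cvg_norm (Ff t))); near=> n.
  by move: t; near: n.
apply/cvgrPdist_le => e e0.
have e40 : 0 < e / 4 by lra.
have [s us sG] := nnsum_approx gG e40.
have := cvg_sum_seq (s := s) Ff => /cvgrPdist_le/(_ _ e40) H.
have gS := is_sum_nnsum gG; have Sf := is_sum_tail us fS gS fg.
near=> n.
have hn : `|\sum_(t <- s) f t - \sum_(t <- s) F n t| <= e / 4 by near: n.
have Fgn : forall t, `|F n t| <= g t by near: n.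
have SFn := is_sum_tail us (FSF n) gS Fgn.
move: Sf SFn hn; rewrite !ler_norml; lra.
Unshelve. all: by end_near. Qed.

End UnorderedSums.

(** * A finite theta identity *)

Section FiniteTheta.
Context {R : realType}.
Implicit Types x y t phi : R.

Lemma cosD2pi_int x (k : int) : cos (x + 2 * pi * k%:~R) = cos x.
Proof.
have h y n : cos (y + 2 * pi * n%:R) = cos y :> R.
  have -> : 2 * pi * n%:R = (pi *+ 2) *+ n :> R by rewrite -[_ *+ 2 *+ n]mulr_natr -[pi *+ 2]mulr_natr; ring.
  by rewrite (periodicn (@cosD2pi R)).
case: k => n; first exact: h.
by rewrite NegzE -[LHS](h _ n.+1); congr cos; rewrite mulrNz -pmulrn; ring.
Qed.

Lemma sinD2pi_int x (k : int) : sin (x + 2 * pi * k%:~R) = sin x.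
Proof.
rewrite -!cosBpihalf -[RHS](cosD2pi_int _ k); congr cos; ring.
Qed.

(** Two steps of Pascal's rule for the centred row. Indexing by the absolute value makes the
    coefficient even in [z] and zero beyond [m]; at z = 0 both neighbours are the same entry, and
    the symmetry of the row is used. *)
Lemma bin_central_rec m (z : int) :
  ('C(2 * m.+1, m.+1 + `|z|) =
  'C(2 * m, m + `|(z - 1)%R|) + 2 * 'C(2 * m, m + `|z|) + 'C(2 * m, m + `|(z + 1)%R|))%N.
Proof.
have sym k : ('C(2 * k.+1, k.+2) = 'C(2 * k.+1, k))%N.
  by rewrite -bin_sub; [congr ('C(_, _)); lia|lia].
have E2 : (2 * m.+1 = (2 * m).+2)%N by lia.
have pascal k : 'C((2 * m).+2, k.+2) = ('C(2 * m, k) + 2 * 'C(2 * m, k.+1) + 'C(2 * m, k.+2))%N.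
  rewrite !binS; lia.
have [||] : [\/ exists k, z = Posz k.+1, exists k, z = - Posz k.+1 | z = 0].
- by case: z => [[|n]|n]; [constructor 3|constructor 1; exists n|constructor 2; exists n].
- move=> [k ->]; rewrite E2.
  have -> : (m.+1 + `|Posz k.+1| = (m + k).+2)%N by lia.
  have -> : (m + `|(Posz k.+1 - 1)%R| = m + k)%N by lia.
  have -> : (m + `|Posz k.+1| = (m + k).+1)%N by lia.
  have -> : (m + `|(Posz k.+1 + 1)%R| = (m + k).+2)%N by lia.
  exact: pascal.
- move=> [k ->]; rewrite E2.
  have -> : (m.+1 + `|(- Posz k.+1)%R| = (m + k).+2)%N by lia.
  have -> : (m + `|(- Posz k.+1 - 1)%R| = (m + k).+2)%N by lia.
  have -> : (m + `|(- Posz k.+1)%R| = (m + k).+1)%N by lia.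
  have -> : (m + `|(- Posz k.+1 + 1)%R| = (m + k))%N by lia.
  rewrite pascal; lia.
- move=> ->; rewrite E2.
  rewrite absz0 sub0r abszN add0r absz1 !addn0.
  case: m pascal {E2} => [//|m] pascal.
  by rewrite pascal !addn1 sym; lia.
Qed.

(** Real form of the expansion of (e^(ix) + e^(-ix))^(2m). The phase is quantified in the induction,
    since the extra factor (2 cos x)^2 = 2 + 2 cos 2x moves [phi] by 2x and by -2x. *)
Lemma cos_pow_expand m x phi :
  is_sum (fun z : int => 'C(2 * m, m + `|z|)%N%:R * cos (phi + 2 * x * z%:~R))
    ((2 * cos x) ^+ (2 * m) * cos phi).
Proof.
elim: m phi => [|m ih] phi.
  rewrite muln0 expr0 mul1r; apply: eq_is_sum (is_sum_delta 0 (cos phi)) => z.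
  have [->|z0] := eqVneq z 0; first by rewrite absz0 mulr0 addr0 mul1r.
  by rewrite add0n bin_small ?mul0r// lt0n absz_eq0.
pose e1 (z : int) : int := z - 1; pose e2 (z : int) : int := z + 1.
have b1 : bijective e1 by exists e2 => z; rewrite /e1 /e2; ring.
have b2 : bijective e2 by exists e1 => z; rewrite /e1 /e2; ring.
have h1 := is_sum_reindex b1 (ih (phi + 2 * x)).
have h2 := is_sum_reindex b2 (ih (phi - 2 * x)).
have := is_sumD h1 (is_sumD (is_sumZ 2 (ih phi)) h2).
have -> : (2 * cos x) ^+ (2 * m) * cos (phi + 2 * x) +
  (2 * ((2 * cos x) ^+ (2 * m) * cos phi) +
   (2 * cos x) ^+ (2 * m) * cos (phi - 2 * x)) =
  (2 * cos x) ^+ (2 * m.+1) * cos phi.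
  have -> : (2 * m.+1 = 2 * m + 2)%N by lia.
  have -> : 2 * x = x *+ 2 by rewrite mulr_natl.
  rewrite exprD cosD cosB cos_mulr2n -[_ ^+ 2 *+ 2]mulr_natr; ring.
apply: eq_is_sum => z /=; rewrite bin_central_rec !natrD /e1 /e2.
have -> : phi + 2 * x + 2 * x * (z - 1)%:~R = phi + 2 * x * z%:~R.
  by rewrite intrD mulrNz; ring.
have -> : phi - 2 * x + 2 * x * (z + 1)%:~R = phi + 2 * x * z%:~R.
  by rewrite intrD; ring.
by ring.
Qed.

(** Orthogonality of the characters of Z/l. Reducing [k] to its residue [r] puts y = pi r / l
    strictly between 0 and pi when r is not 0; then sin y > 0, and multiplying by 2 sin y makes the
    sum telescope over a full period. *)
Lemma sum_cos_roots (l : nat) (k : int) t : (0 < l)%N ->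
  \sum_(i < l) cos (t + 2 * pi * k%:~R * i%:R / l%:R) =
  (if (l %| k)%Z then l%:R * cos t else 0) :> R.
Proof.
move=> l0; have lR : l%:R != 0 :> R by rewrite pnatr_eq0 -lt0n.
have kE := divz_eq k l.
have lz : Posz l != 0 by rewrite eqz_nat -lt0n.
set q := (k %/ l)%Z in kE; set r := (k %% l)%Z in kE.
have r0 : 0 <= r by apply: modz_ge0.
have rl : r < l by rewrite ltz_mod.
transitivity (\sum_(i < l) cos (t + 2 * (pi * r%:~R / l%:R) * i%:R)).
  apply: eq_bigr => i _; rewrite -[RHS](cosD2pi_int _ (q * i)); congr cos.
  rewrite kE intrD !intrM -!pmulrn; field.
  by rewrite pmulrn in lR *.
have -> : (l %| k)%Z = (r == 0) by apply/dvdz_mod0P/eqP.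
have [->|rn0] := eqVneq r 0.
  under eq_bigr do rewrite mulr0 mul0r mulr0 mul0r addr0.
  by rewrite sumr_const card_ord mulr_natl.
set y := pi * r%:~R / l%:R.
have siny : 0 < sin y.
  apply: sin_gt0_pi; rewrite /y; apply/andP; split.
    rewrite divr_gt0 ?ltr0n// mulr_gt0 ?pi_gt0// ltr0z lt_def rn0; exact: r0.
  rewrite ltr_pdivrMr ?ltr0n// ltr_pM2l ?pi_gt0//.
  by rewrite -[l%:R]/(l%:~R) ltr_int.
have tele n : 2 * sin y * (\sum_(i < n) cos (t + 2 * y * i%:R)) =
    sin (t + 2 * y * n%:R - y) - sin (t - y).
  elim: n => [|n ih]; first by rewrite big_ord0 mulr0 mulr0 addr0 subrr.
  rewrite big_ord_recr/= mulrDr ih.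
  have -> : t + 2 * y * n.+1%:R - y = (t + 2 * y * n%:R) + y.
    by rewrite -natr1; ring.
  by rewrite (sinD _ y) (sinB _ y); ring.
have := tele l.
have -> : t + 2 * y * l%:R - y = (t - y) + 2 * pi * r%:~R by rewrite /y; field.
rewrite sinD2pi_int subrr => /eqP; rewrite mulf_eq0 => /orP[|/eqP//].
by rewrite mulf_eq0 pnatr_eq0/= gt_eqF.
Qed.

(** Expand at x = pi (i + t) / l with a phase of frequency -r. Summing over i keeps exactly the
    indices z congruent to r modulo l, which are r + k l. *)
Lemma finite_theta (l m : nat) (r : int) t phi : (0 < l)%N ->
  is_sum (fun k : int => l%:R * 'C(2 * m, m + `|(r + k * l)%R|)%N%:R *
                         cos (phi + 2 * pi * t * k%:~R))
    (\sum_(i < l) (2 * cos (pi * (i%:R + t) / l%:R)) ^+ (2 * m) *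
       cos (phi - 2 * pi * r%:~R * (i%:R + t) / l%:R)).
Proof.
move=> l0; have lR : l%:R != 0 :> R by rewrite pnatr_eq0 -lt0n.
have := is_sum_big (fun (i : 'I_l) (_ : i \in index_enum 'I_l) =>
  cos_pow_expand m (pi * (i%:R + t) / l%:R)
    (phi - 2 * pi * r%:~R * (i%:R + t) / l%:R)).
pose f (z : int) := if (l %| (z - r)%R)%Z then
  l%:R * 'C(2 * m, m + `|z|)%N%:R * cos (phi + 2 * pi * t * (z - r)%:~R / l%:R) else 0 : R.
move=> h; have {h} : is_sum f (\sum_(i < l) (2 * cos (pi * (i%:R + t) / l%:R)) ^+ (2 * m) *
       cos (phi - 2 * pi * r%:~R * (i%:R + t) / l%:R)).
  apply: eq_is_sum h => z; rewrite /f -mulr_sumr.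
  have -> : \sum_(i < l) cos (phi - 2 * pi * r%:~R * (i%:R + t) / l%:R +
      2 * (pi * (i%:R + t) / l%:R) * z%:~R) =
      \sum_(i < l) cos (phi + 2 * pi * t * (z - r)%:~R / l%:R +
         2 * pi * (z - r)%:~R * i%:R / l%:R).
    by apply: eq_bigr => i _; congr cos; rewrite intrB; field.
  by rewrite sum_cos_roots//; case: ifP => _; ring.
have ie : injective (fun k : int => r + k * l).
  by move=> k k' /addrI/mulIf; apply; rewrite eqz_nat -lt0n.
move=> /(is_sum_pullback ie) h; apply: eq_is_sum (h _).
  move=> k /=; rewrite /f addrAC subrr add0r dvdz_mull// intrM -[l%:~R]/(l%:R).
  by congr (_ * cos _); field.
move=> z zn; rewrite /f; case: ifPn => // /dvdzP[k zk].
by have := zn k; rewrite -zk addrC subrK eqxx.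
Qed.

End FiniteTheta.

(** * Elementary bounds *)

Section Limits.
Context {R : realType}.
Implicit Types x y t : R.

(** Each Taylor bound below integrates the previous one: cos <= 1, then [sin_le], [cos_ge],
    [sin_ge]. *)
Lemma ge0_of_derive (f df : R -> R) : (forall x, is_derive x 1 f (df x)) ->
  f 0 = 0 -> (forall x, 0 < x -> 0 <= df x) -> forall x, 0 <= x -> 0 <= f x.
Proof.
move=> fdf f0 df0 x; rewrite le_eqVlt => /predU1P[<-|x0]; first by rewrite f0.
have cf : {within `[0, x], continuous f}%classic.
  apply: continuous_subspaceT => z; apply: differentiable_continuous.
  by apply/derivable1_diffP; have [] := fdf z.
have [c] := MVT x0 (fun z _ => fdf z) cf.
rewrite in_itv/= => /andP[c0 _]; rewrite f0 !subr0 => ->.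
by rewrite mulr_ge0 ?df0// ltW.
Qed.

Lemma sin_le x : 0 <= x -> sin x <= x.
Proof.
move=> x0; rewrite -subr_ge0; move: x x0.
apply: (@ge0_of_derive (fun x => x - sin x) (fun x => 1 - cos x)).
- by rewrite sin0 subr0.
- by move=> z _; rewrite subr_ge0 cos_le1.
Qed.

Lemma cos_ge x : 0 <= x -> 1 - x ^+ 2 / 2 <= cos x.
Proof.
move=> x0; suff : 0 <= cos x - 1 + 2^-1 * x ^+ 2 by lra.
move: x x0; apply: (@ge0_of_derive _ (fun x => x - sin x)).
- move=> z; apply: is_derive_eq; rewrite /GRing.scale /=; lra.
- by rewrite cos0 expr0n/= mulr0 subrr addr0.
- by move=> z z0; rewrite subr_ge0 sin_le// ltW.
Qed.

Lemma sin_ge x : 0 <= x -> x - x ^+ 3 / 6 <= sin x.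
Proof.
move=> x0; suff : 0 <= sin x - x + 6^-1 * x ^+ 3 by lra.
move: x x0; apply: (@ge0_of_derive _ (fun x => cos x - (1 - x ^+ 2 / 2))).
- move=> z; apply: is_derive_eq; rewrite /GRing.scale /=; lra.
- by rewrite sin0 expr0n/= mulr0 subrr addr0.
- by move=> z z0; rewrite subr_ge0 cos_ge// ltW.
Qed.

Lemma sin_sub_le x : `|sin x - x| <= `|x| ^+ 3.
Proof.
wlog x0 : x / 0 <= x => [hw|].
  have [/hw//|/ltW x0] := lerP 0 x.
  by have := hw (- x); rewrite oppr_ge0 sinN normrN -opprD normrN; exact.
rewrite (ger0_norm x0) ler_norml; apply/andP; split.
  have := sin_ge x0; have := exprn_ge0 3 x0; lra.
by have := sin_le x0; have := exprn_ge0 3 x0; lra.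
Qed.

(** For 0 <= x <= 2 one has x - x^3/6 >= x/3. The range exceeds pi/2, which leaves room for the
    shift [s] in [disc_lhs_dom]. *)
Lemma sin_sqr_ge x : `|x| <= 2 -> x ^+ 2 / 9 <= sin x ^+ 2.
Proof.
wlog x0 : x / 0 <= x => [hw|].
  have [/hw//|/ltW x0] := lerP 0 x.
  by have := hw (- x); rewrite oppr_ge0 sinN normrN !sqrrN; exact.
rewrite ger0_norm// => x2.
have h : x / 3 <= sin x.
  apply: le_trans (sin_ge x0).
  have : 0 <= x * (4 - x ^+ 2) by rewrite mulr_ge0//; nra.
  rewrite exprS; lra.
have -> : x ^+ 2 / 9 = (x / 3) ^+ 2 by field.
by rewrite lerXn2r ?nnegrE//; lra.
Qed.

Lemma pow_onem_le t m : 0 <= t <= 1 -> (1 - t) ^+ m <= expR (- (m%:R * t)).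
Proof.
move=> t01; rewrite -mulrN expRM_natl lerXn2r ?nnegrE ?expR_ge0//; first lra.
exact: expR_ge1Dx.
Qed.

(** Because 1/(1 - t) = 1 + t/(1 - t) <= exp(t/(1 - t)). *)
Lemma pow_onem_ge t m : 0 <= t < 1 -> expR (- (m%:R * t / (1 - t))) <= (1 - t) ^+ m.
Proof.
move=> t01; rewrite -mulrA -mulrN expRM_natl lerXn2r ?nnegrE ?expR_ge0//; first lra.
rewrite expRN -[leRHS]invrK lef_pV2 ?posrE ?expR_gt0 ?invr_gt0//; last lra.
apply: le_trans (expR_ge1Dx _); rewrite le_eqVlt; apply/orP; left; apply/eqP.
by field; lra.
Qed.

(** * Binomial coefficients near the centre of a row *)

Lemma bin_step m i : (i <= m)%N ->
  'C(2 * m, m + i.+1)%N%:R = 'C(2 * m, m + i)%N%:R * ((m%:R - i%:R) / (m%:R + i%:R + 1)) :> R.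
Proof.
move=> im; have := mul_bin_left (2 * m) (m + i).
have -> : (2 * m - (m + i) = m - i)%N by lia.
move=> /(congr1 (fun n : nat => n%:R : R)); rewrite !natrM natrB// -natr1 natrD => h.
have n0 : m%:R + i%:R + 1 != 0 :> R by rewrite -natrD natr1 pnatr_eq0.
by rewrite addnS mulrA [X in X / _]mulrC -h mulrAC mulfV// mul1r.
Qed.

(** The ratio of neighbours is 1 - (2i+1)/(m+i+1) <= exp(-(2i+1)/(m+N)), and the odd numbers add up
    to i^2. The parameter [N] serves two purposes: N = i gives the sharp limit, N = m a majorant for
    the whole row. *)
Lemma bin_gauss_le m N i : (0 < m)%N -> (i <= N)%N -> (N <= m)%N ->
  'C(2 * m, m + i)%N%:R <=
  'C(2 * m, m)%:R * expR (- (i%:R ^+ 2 / (m%:R + N%:R))) :> R.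
Proof.
move=> m0 + Nm; have m0R : 0 < m%:R :> R by rewrite ltr0n.
have N0R : 0 <= N%:R :> R by [].
elim: i => [_|i ih iN]; first by rewrite addn0 expr0n/= mul0r oppr0 expR0 mulr1.
rewrite bin_step; last by lia.
have iR : i%:R + 1 <= N%:R :> R by rewrite natr1 ler_nat.
have NmR : N%:R <= m%:R :> R by rewrite ler_nat.
have i0R : 0 <= i%:R :> R by [].
have -> : expR (- (i.+1%:R ^+ 2 / (m%:R + N%:R))) =
    expR (- (i%:R ^+ 2 / (m%:R + N%:R))) * expR (- ((2 * i%:R + 1) / (m%:R + N%:R))) :> R.
  rewrite -expRD; congr expR; rewrite -natr1; field; lra.
rewrite [leRHS]mulrA ler_pM//; first by rewrite divr_ge0; lra.
  by apply: ih; lia.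
apply: le_trans (expR_ge1Dx _).
have -> : (m%:R - i%:R) / (m%:R + i%:R + 1) = 1 - (2 * i%:R + 1) / (m%:R + i%:R + 1) :> R.
  by field; lra.
rewrite lerD2l lerN2 ler_pM2l; last lra.
by rewrite lef_pV2 ?posrE; lra.
Qed.

(** Same telescoping with the inverse ratio 1 + (2i+1)/(m-i) <= exp((2i+1)/(m-N)). *)
Lemma bin_gauss_ge m N i : (i <= N)%N -> (N < m)%N ->
  'C(2 * m, m)%:R * expR (- (i%:R ^+ 2 / (m%:R - N%:R))) <=
  'C(2 * m, m + i)%N%:R :> R.
Proof.
move=> + Nm; have NmR : N%:R + 1 <= m%:R :> R by rewrite natr1 ler_nat.
elim: i => [_|i ih iN]; first by rewrite addn0 expr0n/= mul0r oppr0 expR0 mulr1.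
rewrite bin_step; last by lia.
have iR : i%:R + 1 <= N%:R :> R by rewrite natr1 ler_nat.
have i0R : 0 <= i%:R :> R by [].
have -> : expR (- (i.+1%:R ^+ 2 / (m%:R - N%:R))) =
    expR (- (i%:R ^+ 2 / (m%:R - N%:R))) * expR (- ((2 * i%:R + 1) / (m%:R - N%:R))) :> R.
  rewrite -expRD; congr expR; rewrite -natr1; field; lra.
rewrite [leLHS]mulrA ler_pM ?mulr_ge0 ?expR_ge0//; first by apply: ih; lia.
rewrite expRN -[leRHS]invrK lef_pV2 ?posrE ?expR_gt0 ?invr_gt0 ?divr_gt0//; try lra.
apply: le_trans (expR_ge1Dx _).
have -> : ((m%:R - i%:R) / (m%:R + i%:R + 1))^-1 = 1 + (2 * i%:R + 1) / (m%:R - i%:R) :> R.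
  by field; lra.
rewrite lerD2l ler_pM2l; last lra.
by rewrite lef_pV2 ?posrE; lra.
Qed.

Lemma bin_gauss_dom m i : (0 < m)%N ->
  'C(2 * m, m + i)%N%:R <= 'C(2 * m, m)%:R * expR (- (i%:R ^+ 2 / (2 * m%:R))) :> R.
Proof.
move=> m0; have [im|mi] := leqP i m.
  have -> : 2 * m%:R = m%:R + m%:R :> R by ring.
  exact: bin_gauss_le.
have h : (2 * m < m + i)%N by lia.
by rewrite (bin_small h) mulr_ge0 ?expR_ge0.
Qed.

(** The weight m + 1 makes this sequence nonincreasing, so it converges by monotonicity;
    [central_limit] identifies the limit as 1/pi. *)
Definition central m : R := (m%:R + 1) * ('C(2 * m, m)%:R / 4 ^+ m) ^+ 2.

Lemma centralS m : 'C(2 * m.+1, m.+1)%:R =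
  'C(2 * m, m)%:R * (2 * (2 * m%:R + 1) / (m%:R + 1)) :> R.
Proof.
have := bin_central_rec m 0; rewrite absz0 sub0r abszN add0r absz1 !addn0 => ->.
rewrite !natrD bin_step// addn0 subr0 addr0; field.
by rewrite natr1 pnatr_eq0.
Qed.

Lemma central_cvg : exists2 L : R, 0 <= L & (central m @[m --> \oo] --> L)%classic.
Proof.
have c0 m : 0 <= central m by rewrite mulr_ge0// ?sqr_ge0// addr_ge0.
have cv : cvgn central.
  apply: nonincreasing_is_cvgn; last by exists 0 => _ [m _ <-].
  apply/nonincreasing_seqP => m.
  rewrite /central centralS [4 ^+ m.+1]exprS -natr1.
  have m0 : 0 <= m%:R :> R by [].
  set b := _ / 4 ^+ m.
  have -> : 'C(2 * m, m)%:R * (2 * (2 * m%:R + 1) / (m%:R + 1)) / (4 * 4 ^+ m) =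
    b * ((2 * m%:R + 1) / (2 * (m%:R + 1))) :> R.
    rewrite /b; field; rewrite expf_neq0//=; lra.
  rewrite exprMn mulrCA [leRHS]mulrC ler_wpM2l ?sqr_ge0//.
  rewrite exprMn exprVn mulrA ler_pdivrMr ?exprn_gt0//; nra.
exists (limn central); last exact: cv.
by apply: limr_ge => //; apply: nearW.
Qed.

End Limits.

(** * Scaling limits *)

Section Scaling.
Context {R : realType}.
Implicit Types A u x y t c L : R.
Local Open Scope classical_set_scope.
Local Open Scope ring_scope.

(* [field] would otherwise unfold [pi] to a doubled [get] and [n.+1%:R] to a sum. *)
Local Ltac nfield n :=
  have := @ltr0Sn R n; have := @pi_gt0 R; move: (n.+1%:R : R) (@pi R) => ? ? ? ?;
  field; lra.

Definition scale_bin (A : R) (n : nat) : nat := Num.truncn (A * n.+1%:R ^+ 2 / pi).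
(** The finite identity has integer residues only, so a real [u] is reached as the limit of r/l,
    with l = n.+1. *)
Definition scale_shift (u : R) (n : nat) : int := Num.floor (u * n.+1%:R).

Lemma scale_bin_bounds A n : 0 < A ->
  A / pi - n.+1%:R ^- 2 <= (scale_bin A n)%:R / n.+1%:R ^+ 2 <= A / pi.
Proof.
move=> A0; have n0 : 0 < n.+1%:R ^+ 2 :> R by rewrite exprn_gt0// ltr0n.
have x0 : 0 <= A * n.+1%:R ^+ 2 / pi by rewrite divr_ge0 ?pi_ge0// mulr_ge0 ?ltW.
have := truncn_itv x0; rewrite -/(scale_bin A n) -[(scale_bin A n).+1%:R]natr1 => /andP[h1 h2].
have -> : A / pi - n.+1%:R ^- 2 = (A * n.+1%:R ^+ 2 / pi - 1) / n.+1%:R ^+ 2.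
  by nfield n.
rewrite ler_pdivlMr// ler_pdivrMr//.
have -> : A / pi * n.+1%:R ^+ 2 = A * n.+1%:R ^+ 2 / pi by rewrite mulrAC.
by rewrite divfK ?gt_eqF// h1 andbT; lra.
Qed.

Lemma cvg_near_eq (f g : nat -> R) L :
  (\forall n \near \oo, f n = g n) -> f @ \oo --> L -> g @ \oo --> L.
Proof. by move=> fg; apply: cvg_trans; exact: near_eq_cvg. Qed.

Lemma cvg_invS : (n.+1%:R^-1 : R) @[n --> \oo] --> (0 : R).
Proof. exact: cvg_harmonic. Qed.

Lemma scale_bin_cvg A : 0 < A -> ((scale_bin A n)%:R / n.+1%:R ^+ 2 : R) @[n --> \oo] --> A / pi.
Proof.
move=> A0; have h : (fun n => A / pi - n.+1%:R^-1 ^+ 2) @ \oo --> A / pi.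
  rewrite -[X in _ --> X]subr0; apply: cvgB; first exact: cvg_cst.
  rewrite -(mulr0 0); under eq_fun do rewrite expr2; exact: cvgM cvg_invS cvg_invS.
apply: (squeeze_cvgr _ h (cvg_cst (A / pi))); apply: nearW => n.
by rewrite exprVn scale_bin_bounds.
Qed.

Lemma near_scale_bin A (N : nat) : 0 < A -> \forall n \near \oo, (N <= scale_bin A n)%N.
Proof.
move=> A0; near=> n.
have x0 : 0 <= A * n.+1%:R ^+ 2 / pi by rewrite divr_ge0 ?pi_ge0// mulr_ge0 ?ltW.
rewrite /scale_bin truncn_ge_nat// ler_pdivlMr ?pi_gt0//.
have hn : N%:R * pi / A <= n%:R by near: n; exact: nbhs_infty_ger.
have n1 : 1 <= n.+1%:R :> R by rewrite ler1n.
have : N%:R * pi <= A * n.+1%:R.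
  by rewrite [leRHS]mulrC -ler_pdivrMr// (le_trans hn)// ler_nat.
move=> /le_trans; apply; rewrite ler_pM2l// expr2 ler_peMl//.
Unshelve. all: by end_near. Qed.

Lemma scale_shift_bounds u n :
  u - n.+1%:R^-1 <= (scale_shift u n)%:~R / n.+1%:R <= u.
Proof.
have n0 : 0 < n.+1%:R :> R by rewrite ltr0n.
have /andP[h1 h2] := floor_itv (u * n.+1%:R).
rewrite -/(scale_shift u n) in h1 h2.
have -> : u - n.+1%:R^-1 = (u * n.+1%:R - 1) / n.+1%:R by nfield n.
rewrite ler_pM2r ?invr_gt0// ler_pdivrMr// h1 andbT.
by move: h2; rewrite intrD; lra.
Qed.

Lemma scale_shift_cvg u : ((scale_shift u n)%:~R / n.+1%:R : R) @[n --> \oo] --> u.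
Proof.
have h : (fun n => u - n.+1%:R^-1 : R) @ \oo --> u.
  by rewrite -[X in _ --> X]subr0; apply: cvgB; [exact: cvg_cst|exact: cvg_invS].
apply: (squeeze_cvgr _ h (cvg_cst u)); apply: nearW => n.
exact: scale_shift_bounds.
Qed.

Lemma cvg_expRN (f : nat -> R) x : f @ \oo --> x -> expR (- f n) @[n --> \oo] --> expR (- x).
Proof.
by move=> fx; exact: (continuous_cvg _ (@continuous_expR R (- x)) (cvgN fx)).
Qed.

Lemma pow_onem_cvg (t : nat -> R) (m : nat -> nat) y :
  (forall n, 0 <= t n) -> t @ \oo --> 0 -> (m n)%:R * t n @[n --> \oo] --> y ->
  (1 - t n) ^+ m n @[n --> \oo] --> expR (- y).
Proof.
move=> t0 tc mty.
have h : (m n)%:R * t n / (1 - t n) @[n --> \oo] --> y.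
  rewrite -[X in _ --> X]divr1; apply: cvgM => //; apply: cvgV; first by [].
  rewrite -[X in _ --> X]subr0; apply: cvgB => //; exact: cvg_cst.
apply: (squeeze_cvgr _ (cvg_expRN h) (cvg_expRN mty)); near=> n.
have t1 : t n < 1 by near: n; apply: (cvgr_lt 0).
by rewrite pow_onem_ge ?pow_onem_le// ?t0 ?t1// ltW.
Unshelve. all: by end_near. Qed.

Lemma sin_scaled_cvg y : n.+1%:R * sin (y / n.+1%:R) @[n --> \oo] --> y.
Proof.
have hM : (fun n => y + `|y| ^+ 3 * n.+1%:R^-1) @ \oo --> y.
  rewrite -[X in _ --> X]addr0; apply: cvgD; first exact: cvg_cst.
  by rewrite -(mulr0 (`|y| ^+ 3)); apply: cvgM; [exact: cvg_cst|exact: cvg_invS].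
have hm : (fun n => y - `|y| ^+ 3 * n.+1%:R^-1) @ \oo --> y.
  rewrite -[X in _ --> X]subr0; apply: cvgB; first exact: cvg_cst.
  by rewrite -(mulr0 (`|y| ^+ 3)); apply: cvgM; [exact: cvg_cst|exact: cvg_invS].
apply: (squeeze_cvgr _ hm hM); apply: nearW => n.
have n0 : 0 < n.+1%:R :> R by rewrite ltr0n.
have n1 : 1 <= n.+1%:R :> R by rewrite ler1n.
have : `|n.+1%:R * sin (y / n.+1%:R) - y| <= `|y| ^+ 3 * n.+1%:R^-1.
  have -> : n.+1%:R * sin (y / n.+1%:R) - y = n.+1%:R * (sin (y / n.+1%:R) - y / n.+1%:R).
    by nfield n.
  rewrite normrM (ger0_norm (ltW n0)).
  apply: le_trans (ler_wpM2l (ltW n0) (sin_sub_le _)) _.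
  rewrite normrM normfV (ger0_norm (ltW n0)) exprMn mulrCA ler_wpM2l ?exprn_ge0//.
  rewrite exprVn -[leRHS]mul1r [n.+1%:R ^+ 3]exprS invfM mulrA mulfV ?gt_eqF//.
  by rewrite ler_pM2l// lef_pV2 ?posrE ?exprn_gt0// expr2 ler_peMl// ltW.
by rewrite ler_distl.
Qed.

Lemma central_scaled_cvg A L : 0 < A -> central m @[m --> \oo] --> (L : R) ->
  n.+1%:R * 'C(2 * scale_bin A n, scale_bin A n)%:R / 4 ^+ scale_bin A n
    @[n --> \oo] --> Num.sqrt (pi / A * L).
Proof.
move=> A0 cL; set m := scale_bin A.
have moo : m @ \oo --> \oo.
  by apply/cvgnyPge => N; exact: near_scale_bin.
have cm : central (m n) @[n --> \oo] --> L by exact: cvg_comp moo cL.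
(* The first factor is l^2/(m + 1): it trades the weight in [central] for l^2, so the product is the
   square of the sequence in question. *)
have h : ((m n)%:R / n.+1%:R ^+ 2 + n.+1%:R^-1 ^+ 2)^-1 * central (m n) @[n --> \oo] --> pi / A * L.
  apply: cvgM => //; rewrite -invf_div; apply: cvgV.
    by rewrite mulf_neq0 ?invr_eq0 ?gt_eqF ?pi_gt0.
  rewrite -[X in _ --> X]addr0; apply: cvgD; first exact: scale_bin_cvg.
  rewrite -(mulr0 0); under eq_fun do rewrite expr2; exact: cvgM cvg_invS cvg_invS.
apply: (cvg_near_eq _ (continuous_cvg _ (@sqrt_continuous R (pi / A * L)) h)).
apply: nearW => n /=.
set b := 'C(_, _)%:R.
have -> : ((m n)%:R / n.+1%:R ^+ 2 + n.+1%:R^-1 ^+ 2)^-1 * central (m n) =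
   (n.+1%:R * b / 4 ^+ m n) ^+ 2.
  have m0 : 0 <= (m n)%:R :> R by [].
  have f0 : 0 < 4 ^+ m n :> R by rewrite exprn_gt0.
  rewrite /central -/b; move: (4 ^+ m n) f0 (m n)%:R m0 b => F F0 M M0 b.
  have := @ltr0Sn R n; move: (n.+1%:R : R) => N N0; field.
  by have := mulr_gt0 N0 N0; lra.
by rewrite sqrtr_sqr ger0_norm// divr_ge0 ?mulr_ge0 ?exprn_ge0.
Qed.

(** With j = |r + k l|, the two Gaussian bounds at N = i = j have exponents j^2/(m + j) and j^2/(m -
    j). Since j/l tends to |u + k| and j/l^2 to 0, they share the limit (u + k)^2/(A/pi). *)
Lemma bin_ratio_cvg A u (k : int) : 0 < A ->
  'C(2 * scale_bin A n, scale_bin A n + `|(scale_shift u n + k * n.+1)%R|)%N%:R /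
  'C(2 * scale_bin A n, scale_bin A n)%:R @[n --> \oo] -->
   expR (- (pi * (k%:~R + u) ^+ 2 / A)).
Proof.
move=> A0; set m := scale_bin A; pose j n := `|(scale_shift u n + k * n.+1)%R|%N.
have n0 n : n.+1%:R != 0 :> R by rewrite pnatr_eq0.
have jE n : (j n)%:R / n.+1%:R = `|(scale_shift u n)%:~R / n.+1%:R + k%:~R| :> R.
  rewrite /j natr_absz intr_norm intrD intrM -[(n.+1%:~R)]/(n.+1%:R : R).
  have -> : (scale_shift u n)%:~R / n.+1%:R + k%:~R =
     ((scale_shift u n)%:~R + k%:~R * n.+1%:R) / n.+1%:R :> R.
    by rewrite mulrDl mulfK.
  by rewrite normrM normfV [`|n.+1%:R|]ger0_norm.
have jc : (j n)%:R / n.+1%:R @[n --> \oo] --> `|u + k%:~R|.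
  under eq_fun do rewrite jE.
  by apply: cvg_norm; apply: cvgD; [exact: scale_shift_cvg|exact: cvg_cst].
have jc0 : (j n)%:R / n.+1%:R * n.+1%:R^-1 @[n --> \oo] --> (0 : R).
  by rewrite -(mulr0 `|u + k%:~R|); apply: cvgM => //; exact: cvg_invS.
have mc := scale_bin_cvg A0; rewrite -/m in mc.
have A_neq0 : A / pi != 0 by rewrite mulf_neq0 ?invr_eq0 ?gt_eqF ?pi_gt0.
have yE : pi * (k%:~R + u) ^+ 2 / A = `|u + k%:~R| ^+ 2 / (A / pi).
  by rewrite real_normK ?num_real//; nfield 0%N.
have hp : (j n)%:R ^+ 2 / ((m n)%:R + (j n)%:R) @[n --> \oo] --> pi * (k%:~R + u) ^+ 2 / A.
  rewrite yE -[A / pi]addr0.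
  have : ((j n)%:R / n.+1%:R) ^+ 2 /
    ((m n)%:R / n.+1%:R ^+ 2 + (j n)%:R / n.+1%:R * n.+1%:R^-1) @[n --> \oo] -->
    `|u + k%:~R| ^+ 2 / (A / pi + 0).
    apply: cvgM; first by under eq_fun do rewrite expr2; rewrite expr2; exact: cvgM.
    by apply: cvgV; [rewrite addr0|exact: cvgD].
  apply: cvg_near_eq; near=> n.
  have m0 : (1 <= m n)%N by near: n; exact: near_scale_bin.
  have s0 : (m n)%:R + (j n)%:R != 0 :> R by rewrite -natrD pnatr_eq0; lia.
  have -> : (m n)%:R / n.+1%:R ^+ 2 + (j n)%:R / n.+1%:R * n.+1%:R^-1 =
     ((m n)%:R + (j n)%:R) / n.+1%:R ^+ 2 :> R by nfield n.
  move: s0; move: ((m n)%:R : R) ((j n)%:R : R) => M J s0.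
  have := @ltr0Sn R n; move: (n.+1%:R : R) => N N0; field; lra.
have near_jm : \forall n \near \oo, (j n < m n)%N.
  have hd : (m n)%:R / n.+1%:R ^+ 2 - (j n)%:R / n.+1%:R * n.+1%:R^-1 @[n --> \oo] --> A / pi - 0.
    exact: cvgB.
  near=> n.
  have : 0 < (m n)%:R / n.+1%:R ^+ 2 - (j n)%:R / n.+1%:R * n.+1%:R^-1 :> R.
    near: n; apply: (cvgr_gt _ hd); rewrite subr0 divr_gt0 ?pi_gt0//.
  have -> : (m n)%:R / n.+1%:R ^+ 2 - (j n)%:R / n.+1%:R * n.+1%:R^-1 =
     ((m n)%:R - (j n)%:R) / n.+1%:R ^+ 2 :> R by nfield n.
  by rewrite pmulr_lgt0 ?invr_gt0 ?exprn_gt0 ?ltr0n// subr_gt0 ltr_nat.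
have hm : (j n)%:R ^+ 2 / ((m n)%:R - (j n)%:R) @[n --> \oo] --> pi * (k%:~R + u) ^+ 2 / A.
  rewrite yE -[A / pi]subr0.
  have : ((j n)%:R / n.+1%:R) ^+ 2 /
    ((m n)%:R / n.+1%:R ^+ 2 - (j n)%:R / n.+1%:R * n.+1%:R^-1) @[n --> \oo] -->
    `|u + k%:~R| ^+ 2 / (A / pi - 0).
    apply: cvgM; first by under eq_fun do rewrite expr2; rewrite expr2; exact: cvgM.
    by apply: cvgV; [rewrite subr0|exact: cvgB].
  apply: cvg_near_eq; near=> n.
  have jm : (j n < m n)%N by near: n.
  have s0 : (m n)%:R - (j n)%:R != 0 :> R by rewrite -natrB 1?ltnW// pnatr_eq0; lia.
  have -> : (m n)%:R / n.+1%:R ^+ 2 - (j n)%:R / n.+1%:R * n.+1%:R^-1 =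
     ((m n)%:R - (j n)%:R) / n.+1%:R ^+ 2 :> R by nfield n.
  move: s0; move: ((m n)%:R : R) ((j n)%:R : R) => M J s0.
  have := @ltr0Sn R n; move: (n.+1%:R : R) => N N0; field; lra.
apply: (squeeze_cvgr _ (cvg_expRN hm) (cvg_expRN hp)); near=> n.
have jm : (j n < m n)%N by near: n.
have b0 : 0 < 'C(2 * m n, m n)%:R :> R by rewrite ltr0n bin_gt0; lia.
rewrite ler_pdivlMr// ler_pdivrMr// ![expR _ * _]mulrC.
rewrite bin_gauss_ge//= bin_gauss_le//; lia.
Unshelve. all: by end_near. Qed.

End Scaling.

(** * The theta transformation in one variable *)

Section Theta.
Context {R : realType}.
Implicit Types A u x y s theta t c q L M : R.
Local Open Scope classical_set_scope.
Local Open Scope ring_scope.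

(** * Geometric majorants for Gaussians *)

Lemma nnsum_geometric q : 0 < q < 1 -> exists G, nnsum (fun n : nat => q ^+ n) G.
Proof.
move=> /andP[q0 q1].
have p0 n : (0 <= (q ^+ n)%:E)%E by rewrite lee_fin exprn_ge0 ?ltW.
exists (fine (\esum_(n in [set: nat]) (q ^+ n)%:E)%E); split=> [n|].
  by rewrite exprn_ge0 ?ltW.
rewrite fineK// ge0_fin_numE ?esum_ge0// -nneseries_esumT//.
apply: (@le_lt_trans _ _ (1 / (1 - q))%:E); last exact: ltry.
apply: lime_le; first exact: is_cvg_nneseries.
apply: nearW => n; rewrite sumEFin lee_fin.
have := @geometric_le_lim R n 1 q ler01 q0; rewrite gtr0_norm// => /(_ q1).
by rewrite /series/= /geometric/=; under eq_bigr do rewrite mul1r.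
Qed.

Lemma nnsum_geometric_int q : 0 < q < 1 -> exists G, nnsum (fun k : int => q ^+ `|k|%N) G.
Proof.
move=> q01; have [G qG] := nnsum_geometric q01.
have b1 : nnsum (fun _ : bool => 1) (\sum_(b : bool) 1 : R).
  by apply: is_sum_nnsumE; [move=> _; exact: ler01|exact: is_sum_fin].
pose e (k : int) := match k with Posz n => (true, n) | Negz n => (false, n) end.
have be : bijective e.
  by exists (fun z => if z.1 then Posz z.2 else Negz z.2) => [[]|[[] n]].
apply: (nnsum_le (nnsum_reindex be (nnsum_prod b1 qG))) => k.
have /andP[/ltW q0 /ltW q1] := q01; rewrite exprn_ge0//=.
case: k => n; rewrite /= mul1r//.
by rewrite exprS ler_piMl ?exprn_ge0.
Qed.

Lemma expRN_lt1 c : 0 < c -> 0 < expR (- (2 * c)) < 1.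
Proof. by move=> c0; rewrite expR_gt0 expR_lt1; lra. Qed.

(** If x is within M of k, then x^2 >= 2|x| - 1 >= 2|k| - 2M - 1, so exp(-c x^2) is at most this
    two-sided geometric sequence. *)
Definition gauss_env c M (k : int) : R :=
  expR (c * (1 + 2 * M)) * expR (- (2 * c)) ^+ `|k|%N.

Lemma gauss_env_ge0 c M k : 0 <= gauss_env c M k.
Proof. by rewrite mulr_ge0 ?exprn_ge0 ?expR_ge0. Qed.

Lemma nnsum_gauss_env c M : 0 < c -> exists G, nnsum (gauss_env c M) G.
Proof.
move=> c0; have [G qG] := nnsum_geometric_int (expRN_lt1 c0).
by exists (expR (c * (1 + 2 * M)) * G); apply: nnsumZ; rewrite ?expR_ge0.
Qed.

Lemma gauss_le_env c M x (k : int) : 0 <= c -> `|x - k%:~R| <= M ->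
  expR (- (c * x ^+ 2)) <= gauss_env c M k.
Proof.
move=> c0 xM; rewrite /gauss_env -expRM_natl -expRD ler_expR natr_absz intr_norm.
set K : R := `|k%:~R|.
have KM : K <= `|x| + M.
  have -> : K = `|x - (x - k%:~R)| by rewrite opprB addrC subrK.
  by apply: le_trans (ler_normB _ _) _; rewrite lerD2l.
have xx : x ^+ 2 = `|x| ^+ 2 by rewrite real_normK ?num_real.
have : 0 <= c * (`|x| ^+ 2 + 1 + 2 * M - 2 * K).
  by apply: mulr_ge0 => //; have := sqr_ge0 (`|x| - 1); rewrite sqrrB1 -mulr_natr; lra.
rewrite xx; lra.
Qed.

Lemma gauss_phase_le_env c s (k : int) x : 0 <= c ->
  `|expR (- (c * (k%:~R + s) ^+ 2)) * cos x| <= gauss_env c `|s| k.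
Proof.
move=> c0; rewrite normrM ger0_norm ?expR_ge0//.
apply: le_trans (gauss_le_env c0 (_ : `|k%:~R + s - k%:~R| <= _)); last first.
  by rewrite addrAC subrr add0r.
by rewrite ler_piMr ?expR_ge0// cos_max.
Qed.

(** A full period centred at 0: here |pi k / l| <= pi/2, whereas on 0, ..., l - 1 the power of the
    cosine would be large again near the right end and have no fixed majorant. *)
Definition window (l : nat) : seq int := [seq i%:Z - l./2%:Z | i <- iota 0 l].

Lemma uniq_window l : uniq (window l).
Proof. by rewrite map_inj_uniq ?iota_uniq// => i i' /addIr[]. Qed.

Lemma mem_window l (k : int) : k \in window l -> (2 * `|k| <= l)%N.
Proof. by case/mapP => i; rewrite mem_iota => il ->; lia. Qed.

Lemma windowT l (k : int) : (2 * `|k| < l)%N -> k \in window l.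
Proof.
move=> kl; apply/mapP; exists (`|(k + l./2%:Z)%R|)%N; last by lia.
rewrite mem_iota; lia.
Qed.

Lemma big_window l (f : int -> R) :
  \sum_(k <- window l) f k = \sum_(i < l) f (i%:Z - l./2%:Z).
Proof. by rewrite big_map -{1}[l]subn0 big_mkord. Qed.

(** * Both sides of the finite identity and their limits *)

Section Transform.
Variables (A s u theta : R).
Hypothesis A0 : 0 < A.
Let m := scale_bin A.
Let r := scale_shift u.

(** Extended by 0 off the window, so that all [n] share the index set required by [tannery]. *)
Definition disc_lhs (n : nat) (k : int) : R :=
  if k \in window n.+1 then
    cos (pi * (k%:~R + s) / n.+1%:R) ^+ (2 * m n) *
    cos (theta - 2 * pi * (r n)%:~R * (k%:~R + s) / n.+1%:R) else 0.

Definition disc_rhs (n : nat) (k : int) : R :=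
  n.+1%:R * 'C(2 * m n, m n + `|(r n + k * n.+1)%R|)%N%:R / 4 ^+ m n *
  cos (theta + 2 * pi * s * k%:~R).

Definition disc_sum (n : nat) : R := \sum_(k <- window n.+1)
    (cos (pi * (k%:~R + s) / n.+1%:R) ^+ (2 * m n) *
    cos (theta - 2 * pi * (r n)%:~R * (k%:~R + s) / n.+1%:R)).

Lemma is_sum_disc_lhs n : is_sum (disc_lhs n) (disc_sum n).
Proof. exact: is_sum_seq (uniq_window _). Qed.

Lemma is_sum_disc_rhs n : is_sum (disc_rhs n) (disc_sum n).
Proof.
(* With t = s - floor(l/2), i + t runs through k + s for k in the window. On the other side the
   integer part of t changes each phase by a multiple of 2 pi. The factor 4^-m removes the powers of
   2 from (2 cos)^(2m). *)
have := is_sumZ (4 ^- m n)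
  (finite_theta (m n) (r n) (s - n.+1./2%:R) theta (ltn0Sn n)).
have f0 : 4 ^+ m n != 0 :> R by rewrite expf_neq0.
have -> : disc_sum n = 4 ^- m n * (\sum_(i < n.+1)
    (2 * cos (pi * (i%:R + (s - n.+1./2%:R)) / n.+1%:R)) ^+ (2 * m n) *
      cos (theta - 2 * pi * (r n)%:~R * (i%:R + (s - n.+1./2%:R)) / n.+1%:R)).
  rewrite mulr_sumr /disc_sum big_window; apply: eq_bigr => i _.
  have -> : (i%:Z - n.+1./2%:Z)%:~R + s = i%:R + (s - n.+1./2%:R) :> R.
    by rewrite intrB -!pmulrn; lra.
  have E4 : 2 ^+ (2 * m n) = 4 ^+ m n :> R.
    by rewrite exprM; congr (_ ^+ _); ring.
  by rewrite exprMn E4 !mulrA mulVf ?mul1r.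
apply: eq_is_sum => k; rewrite /disc_rhs.
have -> : cos (theta + 2 * pi * (s - n.+1./2%:R) * k%:~R) =
    cos (theta + 2 * pi * s * k%:~R).
  rewrite -[RHS](cosD2pi_int _ (- (n.+1./2%:Z * k))); congr cos.
  by rewrite mulrNz intrM -pmulrn; lra.
by rewrite mulrA; congr (_ * _); rewrite mulrC.
Qed.

Lemma disc_lhs_cvg k : disc_lhs n k @[n --> \oo] -->
  expR (- (pi * A * (k%:~R + s) ^+ 2)) * cos (theta - 2 * pi * u * (k%:~R + s)).
Proof.
set y := k%:~R + s.
have h1 : (1 - sin (pi * y / n.+1%:R) ^+ 2) ^+ m n @[n --> \oo] --> expR (- (pi * A * y ^+ 2)).
  apply: pow_onem_cvg.
  - by move=> n; exact: sqr_ge0.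
  - have hs : sin (pi * y / n.+1%:R) @[n --> \oo] --> (0 : R).
      rewrite -(@sin0 R); apply: (continuous_cvg _ (@continuous_sin R 0)).
      by rewrite -(mulr0 (pi * y)); apply: cvgM; [exact: cvg_cst|exact: cvg_invS].
    by rewrite -(mulr0 0); under eq_fun do rewrite expr2; exact: cvgM.
  - have -> : pi * A * y ^+ 2 = A / pi * ((pi * y) * (pi * y)).
      by have := @pi_gt0 R; move: (@pi R) => p p0; field; lra.
    apply: (@cvg_near_eq _ (fun n => (m n)%:R / n.+1%:R ^+ 2 *
       ((n.+1%:R * sin (pi * y / n.+1%:R)) * (n.+1%:R * sin (pi * y / n.+1%:R))))).
      apply: nearW => n /=; have := @ltr0Sn R n.
      by move: (sin (pi * y / n.+1%:R)) (n.+1%:R : R) => S N N0; field; lra.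
    apply: cvgM; first exact: scale_bin_cvg.
    by apply: cvgM; exact: sin_scaled_cvg.
have h2 : cos (theta - 2 * pi * (r n)%:~R * y / n.+1%:R) @[n --> \oo] -->
    cos (theta - 2 * pi * u * y).
  apply: (continuous_cvg _ (@continuous_cos R _)); apply: cvgB; first exact: cvg_cst.
  apply: (@cvg_near_eq _ (fun n => 2 * pi * ((r n)%:~R / n.+1%:R) * y)).
    by apply: nearW => n; rewrite [RHS]mulrAC !mulrA.
  apply: cvgM; last exact: cvg_cst.
  by apply: cvgM; [exact: cvg_cst|exact: scale_shift_cvg].
apply: (cvg_near_eq _ (cvgM h1 h2)); near=> n.
rewrite /disc_lhs windowT; first by rewrite exprM cos2sin2.
apply: leq_trans (leqnSn n).
by near: n; exists (2 * `|k|).+1%N.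
Unshelve. all: by end_near. Qed.

(** The rate combines m/l^2 >= A/(2 pi), true for large n, with sin^2 x >= x^2/9 at x = pi (k +
    s)/l. *)
Lemma disc_lhs_dom : exists2 G, nnsum (gauss_env (A * pi / 18) `|s|) G &
  \forall n \near \oo, forall k, `|disc_lhs n k| <= gauss_env (A * pi / 18) `|s| k.
Proof.
have c0 : 0 < A * pi / 18 by rewrite !mulr_gt0 ?pi_gt0.
have [G gG] := nnsum_gauss_env `|s| c0.
exists G => //; near=> n => k; rewrite /disc_lhs; case: ifPn => [kw|_]; last first.
  by rewrite normr0 gauss_env_ge0.
have n0 : 0 < n.+1%:R :> R by [].
set y := k%:~R + s; set x := pi * y / n.+1%:R.
have x2 : `|x| <= 2.
  (* The window accounts for pi/2 in |x| <= 2; this threshold makes pi |s| / l fit into the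
     remaining 2 - pi/2. *)
  have ns : pi * `|s| / (2 - pi / 2) <= n%:R by near: n; exact: nbhs_infty_ger.
  have p2 : 0 < 2 - pi / 2 :> R by rewrite subr_gt0 pihalf_lt2.
  have ns' : pi * `|s| <= n.+1%:R * (2 - pi / 2).
    by rewrite -ler_pdivrMr// (le_trans ns)// ler_nat.
  have kn : 2 * `|k%:~R| <= n.+1%:R :> R.
    by rewrite -intr_norm -natr_absz -natrM ler_nat mem_window.
  rewrite /x !normrM normfV (gtr0_norm (@pi_gt0 R)) (gtr0_norm n0) ler_pdivrMr//.
  apply: (@le_trans _ _ (pi * (`|k%:~R| + `|s|))).
    by rewrite ler_wpM2l ?pi_ge0// ler_normD.
  have := ler_wpM2l (@pi_ge0 R) kn.
  by move: (@pi R) (n.+1%:R : R) ns' => p N h1 h2; lra.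
rewrite normrM; apply: (@le_trans _ _ `|cos x ^+ (2 * m n)|).
  by rewrite ler_piMr// cos_max.
rewrite exprM cos2sin2 ger0_norm; last first.
  by rewrite exprn_ge0// -cos2sin2 sqr_ge0.
have sx1 : sin x ^+ 2 <= 1 by have := sqr_ge0 (cos x); rewrite cos2sin2; lra.
apply: le_trans (pow_onem_le _ _) _; first by rewrite sqr_ge0.
apply: le_trans (gauss_le_env (ltW c0) (_ : `|y - k%:~R| <= _)); last first.
  by rewrite /y addrAC subrr add0r.
rewrite ler_expR lerN2.
have mA : A / pi / 2 <= (m n)%:R / n.+1%:R ^+ 2.
  near: n; apply: (cvgr_ge _ (scale_bin_cvg A0)).
  have : 0 < A / pi by rewrite divr_gt0 ?pi_gt0.
  lra.
apply: (@le_trans _ _ ((m n)%:R * (x ^+ 2 / 9))); last first.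
  by rewrite ler_wpM2l// sin_sqr_ge.
have -> : (m n)%:R * (x ^+ 2 / 9) = (m n)%:R / n.+1%:R ^+ 2 * ((pi * y) ^+ 2 / 9).
  by rewrite /x; move: (pi * y) (n.+1%:R : R) n0 => p N N0; field; lra.
have -> : A * pi / 18 * y ^+ 2 = A / pi / 2 * ((pi * y) ^+ 2 / 9).
  by have := @pi_gt0 R; move: (@pi R) => p p0; field; lra.
by rewrite ler_wpM2r// divr_ge0// sqr_ge0.
Unshelve. all: by end_near. Qed.

Lemma disc_rhsE n k : disc_rhs n k =
  n.+1%:R * 'C(2 * m n, m n)%:R / 4 ^+ m n *
  ('C(2 * m n, m n + `|(r n + k * n.+1)%R|)%N%:R / 'C(2 * m n, m n)%:R) *
  cos (theta + 2 * pi * s * k%:~R).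
Proof.
have b0 : 0 < 'C(2 * m n, m n)%:R :> R by rewrite ltr0n bin_gt0; lia.
have f0 : 0 < 4 ^+ m n :> R by rewrite exprn_gt0.
rewrite /disc_rhs; congr (_ * _).
set b' := 'C(2 * m n, m n + _)%N%:R; move: b'.
move: ('C(2 * m n, m n)%:R : R) (4 ^+ m n : R) b0 f0 => b f b0 f0 b'.
by field; lra.
Qed.

Lemma disc_rhs_cvg L k : central m @[m --> \oo] --> L -> disc_rhs n k @[n --> \oo] -->
  Num.sqrt (pi / A * L) *
  (expR (- (pi * (k%:~R + u) ^+ 2 / A)) * cos (theta + 2 * pi * s * k%:~R)).
Proof.
move=> cL; under eq_fun do rewrite disc_rhsE -mulrA.
apply: cvgM; first exact: central_scaled_cvg.
by apply: cvgM; [exact: bin_ratio_cvg|exact: cvg_cst].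
Qed.

(** The rate pi/(2A) comes from exp(-j^2/(2m)) and m/l^2 <= A/pi. The radius |u| + 1 bounds floor(u
    l)/l, and [K] exceeds the limit of the prefactor by 1. *)
Lemma disc_rhs_dom L : central m @[m --> \oo] --> L ->
  exists c M K G, [/\ 0 < c, nnsum (fun k => K * gauss_env c M k) G &
  \forall n \near \oo, forall k, `|disc_rhs n k| <= K * gauss_env c M k].
Proof.
move=> cL.
have c0 : 0 < pi / (2 * A) by rewrite divr_gt0 ?pi_gt0 ?mulr_gt0.
pose K := Num.sqrt (pi / A * L) + 1.
have K0 : 0 <= K by rewrite addr_ge0 ?sqrtr_ge0.
have [G gG] := nnsum_gauss_env (`|u| + 1) c0.
exists (pi / (2 * A)), (`|u| + 1), K, (K * G); split=> //; first exact: nnsumZ.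
near=> n => k; have n0 : 0 < n.+1%:R :> R by [].
have m0 : (0 < m n)%N by near: n; exact: near_scale_bin.
have m0R : 0 < (m n)%:R :> R by rewrite ltr0n.
have b0 : 0 < 'C(2 * m n, m n)%:R :> R by rewrite ltr0n bin_gt0; lia.
rewrite disc_rhsE normrM; apply: le_trans (ler_piMr _ (cos_max _)) _ => //.
rewrite ger0_norm; last first.
  by rewrite mulr_ge0 ?divr_ge0 ?exprn_ge0// mulr_ge0.
apply: ler_pM.
- by rewrite divr_ge0 ?exprn_ge0// mulr_ge0.
- by rewrite divr_ge0.
- near: n; apply: (cvgr_le _ (central_scaled_cvg A0 cL)); rewrite /K; lra.
set j := `|(r n + k * n.+1)%R|%N.
apply: (@le_trans _ _ (expR (- (j%:R ^+ 2 / (2 * (m n)%:R))))).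
  by rewrite ler_pdivrMr// mulrC bin_gauss_dom.
set x := (r n)%:~R / n.+1%:R + k%:~R : R.
have xk : `|x - k%:~R| <= `|u| + 1.
  have /andP[h1 h2] := scale_shift_bounds u n; rewrite -/(r n) in h1 h2.
  have h3 : n.+1%:R^-1 <= 1 :> R by rewrite invf_le1// ler1n.
  have h4 := ler_norm u; have h5 := ler_norm (- u); rewrite normrN in h5.
  rewrite /x addrK ler_norml.
  move: ((r n)%:~R / n.+1%:R : R) (n.+1%:R^-1 : R) h1 h2 h3 => v w h1 h2 h3.
  by apply/andP; split; lra.
apply: le_trans (gauss_le_env (ltW c0) xk).
rewrite ler_expR lerN2.
have -> : j%:R ^+ 2 = (x * n.+1%:R) ^+ 2 :> R.
  rewrite /j natr_absz intr_norm real_normK ?num_real// intrD intrM /x.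
  by rewrite mulrDl divfK ?gt_eqF// -pmulrn.
have mA : (m n)%:R / n.+1%:R ^+ 2 <= A / pi by have /andP[] := scale_bin_bounds n A0.
rewrite ler_pdivlMr ?mulr_gt0//.
have -> : pi / (2 * A) * x ^+ 2 * (2 * (m n)%:R) =
   (x ^+ 2 * n.+1%:R ^+ 2) * (((m n)%:R / n.+1%:R ^+ 2) / (A / pi)).
  have := @pi_gt0 R; move: (@pi R) (n.+1%:R : R) n0 ((m n)%:R : R) => p N N0 M p0.
  by field; rewrite !gt_eqF.
rewrite exprMn; apply: ler_piMr; first by rewrite mulr_ge0 ?sqr_ge0.
have Ap : 0 < A / pi by rewrite divr_gt0 ?pi_gt0.
by rewrite ler_pdivrMr// mul1r.
Unshelve. all: by end_near. Qed.

(** Both families sum to [disc_sum n] for every n, so their two dominated limits agree. *)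
Lemma theta_transform_const L S S' : central m @[m --> \oo] --> L ->
  is_sum (fun k : int => expR (- (pi * A * (k%:~R + s) ^+ 2)) *
                         cos (theta - 2 * pi * u * (k%:~R + s))) S ->
  is_sum (fun k : int => expR (- (pi * (k%:~R + u) ^+ 2 / A)) *
                         cos (theta + 2 * pi * s * k%:~R)) S' ->
  S = Num.sqrt (pi / A * L) * S'.
Proof.
move=> cL fS gS.
have [G gG dom] := disc_lhs_dom.
have h1 := tannery gG dom disc_lhs_cvg is_sum_disc_lhs fS.
have [c [M [K [G' [_ gG' dom']]]]] := disc_rhs_dom cL.
have h2 := tannery gG' dom' (fun k => disc_rhs_cvg cL (k := k)) is_sum_disc_rhs
  (is_sumZ (Num.sqrt (pi / A * L)) gS).
exact: cvg_unique h1 h2.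
Qed.

End Transform.

Lemma is_sum_theta c s (phase : int -> R) : 0 < c ->
  exists S, is_sum (fun k : int => expR (- (c * (k%:~R + s) ^+ 2)) * cos (phase k)) S.
Proof.
move=> c0; have [G gG] := nnsum_gauss_env `|s| c0.
by apply: is_sum_dom gG _ => k; apply: gauss_phase_le_env; exact: ltW.
Qed.

(* Jacobi's identity at [A = 1] is self-dual, so it pins down the constant and
   Wallis' formula is not needed. *)
Lemma central_limit L : central m @[m --> \oo] --> L -> Num.sqrt (pi * L) = 1.
Proof.
move=> cL; have [S fS] := @is_sum_theta pi 0 (fun=> 0) (@pi_gt0 R).
have f1 : is_sum (fun k : int => expR (- (pi * 1 * (k%:~R + 0) ^+ 2)) *
                         cos (0 - 2 * pi * 0 * (k%:~R + 0))) S.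
  by apply: eq_is_sum fS => k /=; rewrite mulr1 mulr0 mul0r subr0.
have f2 : is_sum (fun k : int => expR (- (pi * (k%:~R + 0) ^+ 2 / 1)) *
                         cos (0 + 2 * pi * 0 * k%:~R)) S.
  apply: eq_is_sum fS => k /=; by rewrite divr1 mulr0 mul0r !addr0.
have := theta_transform_const ltr01 cL f1 f2; rewrite divr1.
(* The term k = 0 equals 1 and the others are nonnegative, so S can be cancelled from S = sqrt(pi L)
   S. *)
have S1 : 1 <= S.
  have fp k : 0 <= expR (- (pi * (k%:~R + 0) ^+ 2)) * cos 0 :> R.
    by rewrite cos0 mulr1 expR_ge0.
  have := is_sumB fS (is_sum_delta (0 : int) (1 : R)) => /is_sum_ge0.
  rewrite subr_ge0; apply => k; case: eqP => [->|_]; last by rewrite subr0.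
  by rewrite addr0 expr0n/= mulr0 oppr0 expR0 cos0 mulr1 subrr.
by move=> /esym/eqP; rewrite -subr_eq0 -{2}(mul1r S) -mulrBl mulf_eq0 subr_eq0
  (gt_eqF (lt_le_trans ltr01 S1)) orbF => /eqP.
Qed.

Lemma theta_transform A s u theta S : 0 < A ->
  is_sum (fun k : int => expR (- (pi * A * (k%:~R + s) ^+ 2)) *
                         cos (theta - 2 * pi * u * (k%:~R + s))) S ->
  is_sum (fun k : int => expR (- (pi / A * (k%:~R + u) ^+ 2)) *
                         cos (theta + 2 * pi * s * k%:~R)) (Num.sqrt A * S).
Proof.
move=> A0 fS; have [L L0 cL] := @central_cvg R.
have pA : 0 < pi / A by rewrite divr_gt0 ?pi_gt0.
have [S' fS'] := is_sum_theta u (fun k => theta + 2 * pi * s * k%:~R) pA.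
suff -> : Num.sqrt A * S = S' by [].
rewrite (theta_transform_const A0 cL fS (S' := S')); last first.
  by apply: eq_is_sum fS' => k; rewrite mulrAC.
rewrite mulrA -sqrtrM ?ltW//.
have -> : A * (pi / A * L) = pi * L.
  by move: (@pi R) => p; field; lra.
by rewrite central_limit// mul1r.
Qed.

End Theta.

(** * The theta transformation in two variables *)

Section Theta2.
Context {R : realType}.
Implicit Types a b c p v w x y s u theta S D : R.

Lemma is_sum_dom2 (f : int * int -> R) k1 k2 s1 s2 : 0 < k1 -> 0 < k2 ->
  (forall z, `|f z| <= expR (- (k1 * (z.1%:~R + s1) ^+ 2)) *
                       expR (- (k2 * (z.2%:~R + s2) ^+ 2))) ->
  exists S, is_sum f S.
Proof.
move=> k10 k20 fle.
have [G1 g1] := nnsum_gauss_env `|s1| k10; have [G2 g2] := nnsum_gauss_env `|s2| k20.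
apply: (is_sum_dom (nnsum_prod g1 g2)) => z; apply: (le_trans (fle z)).
by apply: ler_pM; rewrite ?expR_ge0//; apply: gauss_le_env;
  rewrite ?(ltW k10) ?(ltW k20)// addrAC subrr add0r.
Qed.

Definition qform a b c x y := a * x ^+ 2 + 2 * b * x * y + c * y ^+ 2.

(** The smaller eigenvalue is the determinant divided by the larger one, hence at least determinant
    over trace. The bound separates the variables and gives a product majorant. *)
Lemma qform_ge a b c x y : 0 < a -> 0 < c -> 0 < a * c - b ^+ 2 ->
  (a * c - b ^+ 2) / (a + c) * (x ^+ 2 + y ^+ 2) <= qform a b c x y.
Proof.
move=> a0 c0 D0; have ac0 : 0 < a + c by lra.
set k := _ / (a + c).
have kE : k * (a + c) = a * c - b ^+ 2 by rewrite /k divfK// gt_eqF.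
have ak : 0 < a - k.
  rewrite subr_gt0 /k ltr_pdivrMr//.
  have := exprn_gt0 2 a0; have := sqr_ge0 b; rewrite !expr2; lra.
rewrite -subr_ge0 -(pmulr_rge0 _ ak).
have -> : (a - k) * (qform a b c x y - k * (x ^+ 2 + y ^+ 2)) =
  ((a - k) * x + b * y) ^+ 2 + k ^+ 2 * y ^+ 2 +
  (a * c - b ^+ 2 - k * (a + c)) * y ^+ 2 by rewrite /qform; ring.
by rewrite kE subrr mul0r addr0 addr_ge0 ?sqr_ge0// mulr_ge0 ?sqr_ge0.
Qed.

Lemma is_sum_qform a b c s1 s2 (phase : int * int -> R) :
  0 < a -> 0 < c -> 0 < a * c - b ^+ 2 ->
  exists S, is_sum (fun z : int * int =>
    expR (- (pi * qform a b c (z.1%:~R + s1) (z.2%:~R + s2))) * cos (phase z)) S.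
Proof.
move=> a0 c0 D0; have ac0 : 0 < a + c by lra.
have k0 : 0 < pi * ((a * c - b ^+ 2) / (a + c)) by rewrite mulr_gt0 ?pi_gt0 ?divr_gt0.
apply: (is_sum_dom2 (s1 := s1) (s2 := s2) k0 k0) => z.
rewrite normrM (ger0_norm (expR_ge0 _)) -expRD.
apply: (le_trans (ler_piMr _ (cos_max _))); rewrite ?expR_ge0// ler_expR.
rewrite -opprD lerN2 -mulrDr -!mulrA ler_wpM2l ?pi_ge0// mulrA.
exact: qform_ge.
Qed.

(** The left side is the exponent left by the two successive transforms, the right side the inverse
    form; (D + b^2)/a stands for c. *)
Lemma complete_square p a b D v w u : a != 0 -> D != 0 ->
  - (p / a * v ^+ 2) - p / (D / a) * (w + (u - b / a * v)) ^+ 2 =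
  - (p * qform ((D + b ^+ 2) / a / D) (- b / D) (a / D) v (w + u)).
Proof. by move=> a0 D0; rewrite /qform; field; rewrite a0 D0. Qed.

(* Transform in the first variable, then in the second: after the first step the
   phase is linear in the second variable, which shifts its dual variable. *)
Lemma theta_transform2 a b c s1 s2 u1 u2 theta S :
  0 < a -> 0 < c -> 0 < a * c - b ^+ 2 ->
  is_sum (fun z : int * int =>
    expR (- (pi * qform a b c (z.1%:~R + s1) (z.2%:~R + s2))) *
    cos (theta - 2 * pi * (u1 * (z.1%:~R + s1) + u2 * (z.2%:~R + s2)))) S ->
  is_sum (fun z : int * int =>
    expR (- (pi * qform (c / (a * c - b ^+ 2)) (- b / (a * c - b ^+ 2))
      (a / (a * c - b ^+ 2)) (z.1%:~R + u1) (z.2%:~R + u2))) *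
    cos (theta + 2 * pi * (s1 * z.1%:~R + s2 * z.2%:~R)))
    (Num.sqrt (a * c - b ^+ 2) * S).
Proof.
move=> a0 c0 D0 fS; set D := a * c - b ^+ 2 in D0 *.
have p0 := @pi_gt0 R; have Da : 0 < D / a by rewrite divr_gt0.
pose E2 (z2 : int) : R := expR (- (pi * (D / a) * (z2%:~R + s2) ^+ 2)).
pose E1 (m : int) : R := expR (- (pi / a * (m%:~R + u1) ^+ 2)).
(* From a x^2 + 2b x y + c y^2 = a (x + (b/a) y)^2 + (D/a) y^2: the inner Gaussian is centred by
   (b/a) y, and [th] repays the phase 2 pi u1 (b/a) y that this recentring subtracts. *)
pose s' (z2 : int) : R := s1 + b / a * (z2%:~R + s2).
pose th (z2 : int) : R := theta - 2 * pi * u2 * (z2%:~R + s2)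
  + 2 * pi * u1 * (b / a) * (z2%:~R + s2).
have fin1 z2 : exists T, is_sum (fun k : int => expR (- (pi * a * (k%:~R + s' z2) ^+ 2)) *
    cos (th z2 - 2 * pi * u1 * (k%:~R + s' z2))) T.
  by apply: (is_sum_theta (s' z2)); rewrite mulr_gt0.
have [T1 T1E] := boolp.choice fin1.
have h1 : is_sum (fun z2 => E2 z2 * T1 z2) S.
  apply: is_sum_fubini_swap fS _ => z2.
  apply: eq_is_sum (is_sumZ (E2 z2) (T1E z2)) => k /=.
  rewrite mulrA /E2 -expRD; congr (expR _ * cos _).
    by rewrite /qform /s' /D; field; rewrite gt_eqF.
  by rewrite /th /s'; ring.
(* The mixed family, dual in the first variable only. It is absolutely summable, so summing it in
   either order links the original sum to the fully transformed one. *)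
pose g (z : int * int) := E1 z.1 * E2 z.2 * cos (th z.2 + 2 * pi * s' z.2 * z.1%:~R).
have [Sg gS] : exists Sg, is_sum g Sg.
  apply: (is_sum_dom2 (k1 := pi / a) (k2 := pi * (D / a)) (s1 := u1) (s2 := s2)).
  - by rewrite divr_gt0.
  - by rewrite mulr_gt0.
  move=> z; rewrite /g normrM ger0_norm; last by rewrite mulr_ge0 ?expR_ge0.
  by apply: ler_piMr; rewrite ?cos_max// mulr_ge0 ?expR_ge0.
have SgE : Sg = Num.sqrt a * S.
  apply: is_sum_inj (is_sumZ (Num.sqrt a) h1).
  apply: is_sum_fubini_swap gS _ => z2.
  have := is_sumZ (E2 z2) (theta_transform a0 (T1E z2)).
  rewrite mulrCA; apply: eq_is_sum => m; rewrite /g /E1 /=; ring.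
pose th2 (m : int) := theta + 2 * pi * s1 * m%:~R.
pose u' (m : int) := u2 - b / a * (m%:~R + u1).
have fin2 m : exists T, is_sum (fun k : int => expR (- (pi * (D / a) * (k%:~R + s2) ^+ 2)) *
    cos (th2 m - 2 * pi * u' m * (k%:~R + s2))) T.
  by apply: (is_sum_theta s2); rewrite mulr_gt0.
have [T2 T2E] := boolp.choice fin2.
have h2 : is_sum (fun m => E1 m * T2 m) Sg.
  apply: is_sum_fubini gS _ => m.
  apply: eq_is_sum (is_sumZ (E1 m) (T2E m)) => k /=.
  rewrite /g /= [LHS]mulrA; congr (_ * _ * cos _).
  by rewrite /th2 /u' /th /s'; ring.
have Dn : c / D * (a / D) - (- b / D) ^+ 2 = D^-1.
  rewrite exprMn sqrrN exprVn mulrACA -invfM -expr2 -mulrBl (mulrC c) -/D.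
  by rewrite expr2 invfM mulrA mulfV ?mul1r// gt_eqF.
have Dp : 0 < c / D * (a / D) - (- b / D) ^+ 2 by rewrite Dn invr_gt0.
have [SG GS] := @is_sum_qform (c / D) (- b / D) (a / D) u1 u2
  (fun z => theta + 2 * pi * (s1 * z.1%:~R + s2 * z.2%:~R))
  (divr_gt0 c0 D0) (divr_gt0 a0 D0) Dp.
suff -> : Num.sqrt D * S = SG by [].
have -> : Num.sqrt D * S = Num.sqrt (D / a) * Sg.
  by rewrite SgE mulrA -sqrtrM ?ltW// divfK ?gt_eqF.
apply: is_sum_inj (is_sumZ (Num.sqrt (D / a)) h2) _.
apply: is_sum_fubini GS _ => m.
have := is_sumZ (E1 m) (theta_transform Da (T2E m)).
rewrite mulrCA; apply: eq_is_sum => k /=.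
rewrite mulrA /E1 -expRD; congr (expR _ * cos _).
  have DE : c = (D + b ^+ 2) / a by rewrite /D subrK mulrAC mulfV ?mul1r ?gt_eqF.
  by rewrite /u' DE complete_square ?gt_eqF.
by rewrite /th2; ring.
Qed.

End Theta2.

(** * Fourier sums of periodized Gaussians *)

Section Wigner.
Context {R : realType}.
Implicit Types (s : 'M[R]_2) (theta x y : R) (d j : nat) (n k m : int).

Lemma quad_formE s x y :
  quad_form s x y = s 0 0 * x ^+ 2 + (s 0 1 + s 1 0) * x * y + s 1 1 * y ^+ 2.
Proof.
rewrite /quad_form !mxE !big_ord_recl !big_ord0 !mxE !big_ord_recl !big_ord0 !mxE /=.
have -> : lift ord0 ord0 = 1 :> 'I_2 by apply/val_inj.
ring.
Qed.

Lemma quad_form_sym a b c s x y : s 0 0 = a -> s 0 1 = b -> s 1 0 = b -> s 1 1 = c ->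
  quad_form s x y = qform a b c x y.
Proof. by move=> e00 e01 e10 e11; rewrite quad_formE e00 e01 e10 e11 /qform; ring. Qed.

Section PosDef.
Variable s : 'M[R]_2.
Hypotheses (s_sym : s \is symmetricmx) (s_pos : posdef s).
Let a := s 0 0.
Let b := s 0 1.
Let c := s 1 1.

Lemma symmetric2 : s 1 0 = b.
Proof.
have /is_hermitianmxP := s_sym; rewrite expr0 scale1r => /matrixP/(_ 0 1).
by rewrite /b !mxE => ->.
Qed.

Lemma quad_form_gt0 x y : (x != 0) || (y != 0) -> 0 < qform a b c x y.
Proof.
move=> xy; rewrite -(@quad_form_sym a b c s)//; last exact: symmetric2.
apply: s_pos; apply/eqP => /matrixP h; move: xy.
have := h 0 0; have := h 1 0; rewrite !mxE /= => -> ->.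
by rewrite eqxx.
Qed.

Lemma posdef_a : 0 < a.
Proof.
have := @quad_form_gt0 1 0; rewrite oner_eq0 => /(_ isT); rewrite /qform; lra.
Qed.

Lemma posdef_c : 0 < c.
Proof.
have := @quad_form_gt0 0 1; rewrite oner_eq0 orbT => /(_ isT); rewrite /qform; lra.
Qed.

Lemma posdef_det : 0 < a * c - b ^+ 2.
Proof.
have a0 := posdef_a; rewrite -(pmulr_rgt0 _ a0).
(* At (-b, a) the form takes the value a (a c - b^2). *)
have := @quad_form_gt0 (- b) a; rewrite (gt_eqF a0) orbT => /(_ isT).
by rewrite /qform; lra.
Qed.

Lemma det2 : \det s = a * c - b ^+ 2.
Proof.
rewrite (expand_det_row _ 0) !big_ord_recl big_ord0 /cofactor !det_mx11 !mxE /=.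
have -> : lift ord0 ord0 = 1 :> 'I_2 by apply/val_inj.
have -> : lift (1 : 'I_2) ord0 = 0 :> 'I_2 by apply/val_inj.
rewrite symmetric2 -/a -/b -/c; ring.
Qed.

Lemma invmx2 : invmx s = \matrix_(p < 2, q < 2)
  (if (p == 0) && (q == 0) then c / \det s
   else if (p == 1) && (q == 1) then a / \det s else - b / \det s).
Proof.
have D0 := posdef_det; have dn : \det s != 0 by rewrite det2 gt_eqF.
have su : s \in unitmx by rewrite unitmxE unitfE.
rewrite -[RHS]mul1mx -(mulVmx su) -mulmxA -[LHS]mulmx1; congr (_ *m _).
apply/matrixP => p q; rewrite !mxE !big_ord_recl big_ord0 !mxE /=.
have -> : lift ord0 ord0 = 1 :> 'I_2 by apply/val_inj.
have e2 (i : 'I_2) : i = 0 \/ i = 1.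
  by case: i => -[|[|//]] ?; [left|right]; apply/val_inj.
have [-> | ->] := e2 p; have [-> | ->] := e2 q => /=;
  rewrite ?symmetric2 -/a -/b -/c det2; rewrite det2 in dn; field; exact: dn.
Qed.

Lemma quad_form2 x y : quad_form (2 *: s) x y = qform (2 * a) (2 * b) (2 * c) x y.
Proof. by apply: quad_form_sym; rewrite !mxE// symmetric2. Qed.

Lemma quad_form2V x y : quad_form (2 *: invmx s) x y =
  qform (2 * (c / \det s)) (2 * (- b / \det s)) (2 * (a / \det s)) x y.
Proof. by rewrite invmx2; apply: quad_form_sym; rewrite !mxE. Qed.

End PosDef.

(** Ensures that [fine] in [gauss_shift] returns a genuine sum. Pulling d out of the argument turns
    Q/d into the form d Q at z + h + n/d. *)
Lemma nnsum_gauss_shift (h1 h2 a b c : R) d s n1 n2 : (0 < d)%N ->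
  0 < a -> 0 < c -> 0 < a * c - b ^+ 2 ->
  (forall x y, quad_form s x y = qform a b c x y) ->
  nnsum (fun z : int * int => expR (- (pi / d%:R * qform a b c
      (n1%:~R + (z.1%:~R + h1) * d%:R) (n2%:~R + (z.2%:~R + h2) * d%:R))))
    (gauss_shift h1 h2 d s n1 n2).
Proof.
move=> d0 a0 c0 D0 sE; have dR : 0 < d%:R :> R by rewrite ltr0n.
have a0' : 0 < d%:R * a by rewrite mulr_gt0.
have c0' : 0 < d%:R * c by rewrite mulr_gt0.
have D0' : 0 < d%:R * a * (d%:R * c) - (d%:R * b) ^+ 2.
  have -> : d%:R * a * (d%:R * c) - (d%:R * b) ^+ 2 = d%:R ^+ 2 * (a * c - b ^+ 2) by ring.
  by rewrite mulr_gt0// exprn_gt0.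
have [S hS] := is_sum_qform (h1 + n1%:~R / d%:R) (h2 + n2%:~R / d%:R) (fun=> 0) a0' c0' D0'.
set f := (fun z : int * int => _).
have fS : is_sum f S.
  apply: eq_is_sum hS => z; rewrite /f cos0 mulr1; congr (expR (- _)).
  by rewrite /qform; move: (@pi R) => p; field; rewrite gt_eqF.
have [f0 fE] := is_sum_nnsumE (fun z => expR_ge0 _) fS.
suff -> : gauss_shift h1 h2 d s n1 n2 = S by split.
by rewrite /gauss_shift; under eq_esum do rewrite sE mulNr; rewrite fE.
Qed.

Definition half (e : bool) : R := if e then 2^-1 else 0.

Lemma halfE e : half e = (e : nat)%:R / 2.
Proof. by case: e; rewrite /half ?mul1r ?mul0r. Qed.

Section Fixed.
Variables (s : 'M[R]_2) (d j : nat).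
Hypotheses (s_sym : s \is symmetricmx) (s_pos : posdef s) (dE : d = (2 * j + 1)%N).
Let a := s 0 0.
Let b := s 0 1.
Let c := s 1 1.
Let D := a * c - b ^+ 2.

Let d_gt0 : (0 < d)%N. Proof. by rewrite dE addn1. Qed.
Let dR : 0 < d%:R :> R. Proof. by rewrite ltr0n. Qed.
Let a0 : 0 < a. Proof. exact: posdef_a. Qed.
Let c0 : 0 < c. Proof. exact: posdef_c. Qed.
Let D0 : 0 < D. Proof. exact: posdef_det. Qed.

Let parity2 (w : (bool * bool) * ((int * int) * (int * int))) : (int * int) * (int * int) :=
  let: ((e1, e2), ((g1, g2), (h1, h2))) := w in
  ((g1 - h1, g2 - h2), (g1 + h1 + (e1 : nat)%:Z, g2 + h2 + (e2 : nat)%:Z)).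

(** In each coordinate the sum and the difference of two integers have the same parity, so a single
    bit serves both new variables. *)
Lemma bij_parity2 : bijective parity2.
Proof.
exists (fun w => let: ((a1, a2), (b1, b2)) := w in
  ((((a1 + b1) %% 2)%Z == 1, ((a2 + b2) %% 2)%Z == 1),
   ((((a1 + b1) %/ 2)%Z, ((a2 + b2) %/ 2)%Z),
    (((a1 + b1) %/ 2)%Z - a1, ((a2 + b2) %/ 2)%Z - a2)))).
- move=> [[e1 e2] [[g1 g2] [h1 h2]]] /=.
  congr (_, _, ((_, _), (_, _))); case: e1; case: e2; lia.
- move=> [[a1 a2] [b1 b2]] /=.
  congr ((_, _), (_, _)); do ?case: eqP => /= ?; lia.
Qed.

(* Parallelogram identity: with [al + be = 2 ga + e] and [be - al = 2 de + e],
   [Q(u) + Q(v) = 2 Q((u + v) / 2) + 2 Q((v - u) / 2)]. *)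
Lemma gauss_mul n1 n2 m1 m2 :
  gauss d s (n1 - m1) (n2 - m2) * gauss d s (n1 + m1) (n2 + m2) =
  \sum_(e : bool * bool) gauss_shift (half e.1) (half e.2) d (2 *: s) n1 n2 *
                         gauss_shift (half e.1) (half e.2) d (2 *: s) m1 m2.
Proof.
have sE x y : quad_form s x y = qform a b c x y.
  by apply: quad_form_sym => //; exact: symmetric2.
have h1 := nnsum_gauss_shift 0 0 (n1 - m1) (n2 - m2) d_gt0 a0 c0 D0 sE.
have h2 := nnsum_gauss_shift 0 0 (n1 + m1) (n2 + m2) d_gt0 a0 c0 D0 sE.
apply: (is_sum_finpart bij_parity2 (is_sum_nnsum (nnsum_prod h1 h2))) => -[e1 e2].
have a2 : 0 < 2 * a by rewrite mulr_gt0.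
have c2 : 0 < 2 * c by rewrite mulr_gt0.
have D2 : 0 < 2 * a * (2 * c) - (2 * b) ^+ 2.
  have -> : 2 * a * (2 * c) - (2 * b) ^+ 2 = 4 * D by rewrite /D; ring.
  by rewrite mulr_gt0.
have sE2 := quad_form2 s_sym.
have h3 := nnsum_gauss_shift (half e1) (half e2) n1 n2 d_gt0 a2 c2 D2 sE2.
have h4 := nnsum_gauss_shift (half e1) (half e2) m1 m2 d_gt0 a2 c2 D2 sE2.
apply: eq_is_sum (is_sum_nnsum (nnsum_prod h3 h4)) => -[[g1 g2] [k1 k2]] /=.
rewrite -!expRD; congr expR.
rewrite !halfE /qform !intrD !mulrNz -!pmulrn.
by move: (pi / d%:R) => p; field.
Qed.

Let window2 (w : ('I_(2 * j).+1 * 'I_(2 * j).+1) * (int * int)) : int * int :=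
  ((w.1.1 : nat)%:Z - j%:Z + w.2.1 * d%:Z, (w.1.2 : nat)%:Z - j%:Z + w.2.2 * d%:Z).

(** Every integer is uniquely m + z d with -j <= m <= j, so a finite sum of d-periodizations unfolds
    to a sum over the lattice. *)
Lemma bij_window2 : bijective window2.
Proof.
have lz : (2 * j).+1%:Z != 0 by [].
have dz : d%:Z = (2 * j).+1%:Z by rewrite dE addn1.
pose ix (x : int) : 'I_(2 * j).+1 := inord `|((x + j%:Z) %% (2 * j).+1%:Z)%Z|.
have ixE (x : int) : (ix x : nat)%:Z = ((x + j%:Z) %% (2 * j).+1%:Z)%Z.
  have m0 := modz_ge0 (x + j%:Z) lz; have ml := ltz_mod (x + j%:Z) lz.
  rewrite /ix inordK; first by rewrite gez0_abs.
  by rewrite -ltz_nat gez0_abs.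
have h1 (i : 'I_(2 * j).+1) (z : int) : i%:Z - j%:Z + z * d%:Z + j%:Z = z * (2 * j).+1%:Z + i%:Z.
  by rewrite dz; ring.
have hm (i : 'I_(2 * j).+1) (z : int) : ix (i%:Z - j%:Z + z * d%:Z) = i.
  apply/val_inj/eqP; rewrite -eqz_nat ixE h1 modzMDl modz_small//=.
  by rewrite ltz_nat ltn_ord.
have hd (i : 'I_(2 * j).+1) (z : int) :
    ((i%:Z - j%:Z + z * d%:Z + j%:Z) %/ (2 * j).+1%:Z)%Z = z.
  by rewrite h1 divzMDl// divz_small ?addr0//= ltz_nat ltn_ord.
exists (fun x : int * int => ((ix x.1, ix x.2), (((x.1 + j%:Z) %/ (2 * j).+1%:Z)%Z,
                                   ((x.2 + j%:Z) %/ (2 * j).+1%:Z)%Z))).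
- by move=> [[i1 i2] [z1 z2]]; rewrite /window2 /= !hm !hd.
- have hx (x : int) : (ix x : nat)%:Z - j%:Z + ((x + j%:Z) %/ (2 * j).+1%:Z)%Z * d%:Z = x.
    rewrite ixE dz; have := divz_eq (x + j%:Z) (2 * j).+1%:Z.
    by move=> h; rewrite -[RHS](addrK j%:Z) [X in _ = X - _]h; ring.
  by move=> [x1 x2]; rewrite /window2 /= !hx.
Qed.

Let parity1 (w : (bool * bool) * (int * int)) : int * int :=
  (2 * w.2.1 + (w.1.1 : nat)%:Z, 2 * w.2.2 + (w.1.2 : nat)%:Z).

Lemma bij_parity1 : bijective parity1.
Proof.
exists (fun x : int * int => (((x.1 %% 2)%Z == 1, (x.2 %% 2)%Z == 1), ((x.1 %/ 2)%Z, (x.2 %/ 2)%Z))).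
- move=> [[e1 e2] [g1 g2]]; rewrite /parity1 /=.
  congr (_, _, (_, _)); case: e1; case: e2; lia.
- move=> [x1 x2]; rewrite /parity1 /=.
  congr (_, _); do ?case: eqP => /= ?; lia.
Qed.

Lemma sum_symE (V : nmodType) (F : int -> V) :
  sum_sym j F = \sum_(i < (2 * j).+1) F ((i : nat)%:Z - j%:Z).
Proof. by rewrite /sum_sym addn1. Qed.

(* The finite Fourier sum of a periodized Gaussian is a sum over the whole of
   [Z x Z], to which [theta_transform2] applies; the signs come from the half
   shifts, [d] being odd. *)
Lemma gauss_fourier theta k1 k2 (e : bool * bool) :
  sum_sym j (fun m1 => sum_sym j (fun m2 =>
    cos (theta - 4 * pi / d%:R * (k1 * m1 + k2 * m2)%:~R) *
    gauss_shift (half e.1) (half e.2) d (2 *: s) m1 m2)) =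
  d%:R / (2 * Num.sqrt (\det s)) * (cos theta *
   \sum_(f : bool * bool) (-1) ^+ ((e.1 && f.1) (+) (e.2 && f.2)) *
      gauss_shift (half f.1) (half f.2) d (2 *: invmx s) k1 k2).
Proof.
have a2 : 0 < 2 * a by rewrite mulr_gt0.
have c2 : 0 < 2 * c by rewrite mulr_gt0.
have D2 : 0 < 2 * a * (2 * c) - (2 * b) ^+ 2.
  have -> : 2 * a * (2 * c) - (2 * b) ^+ 2 = 4 * D by rewrite /D; ring.
  by rewrite mulr_gt0.
have detE : \det s = D by exact: det2.
pose a' := 2 * a / d%:R; pose b' := 2 * b / d%:R; pose c' := 2 * c / d%:R.
have a0' : 0 < a' by rewrite divr_gt0.
have c0' : 0 < c' by rewrite divr_gt0.
have D'E : a' * c' - b' ^+ 2 = 4 * D / d%:R ^+ 2.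
  by rewrite /a' /b' /c' /D; field; rewrite gt_eqF.
have D0' : 0 < a' * c' - b' ^+ 2 by rewrite D'E divr_gt0 ?mulr_gt0 ?exprn_gt0.
pose s1 := half e.1 * d%:R; pose s2 := half e.2 * d%:R.
pose u1 := 2 * k1%:~R / d%:R : R; pose u2 := 2 * k2%:~R / d%:R : R.
(* The transform pairs u with z + s but the character with z alone; [th] makes up the difference,
   which is 2 pi times the integer e1 k1 + e2 k2 and disappears at the end. *)
pose th := theta + 2 * pi * (u1 * s1 + u2 * s2).
have [S fS] := is_sum_qform s1 s2 (fun z : int * int =>
  th - 2 * pi * (u1 * (z.1%:~R + s1) + u2 * (z.2%:~R + s2))) a0' c0' D0'.
have gS := theta_transform2 a0' c0' D0' fS.
have -> : sum_sym j (fun m1 => sum_sym j (fun m2 =>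
    cos (theta - 4 * pi / d%:R * (k1 * m1 + k2 * m2)%:~R) *
    gauss_shift (half e.1) (half e.2) d (2 *: s) m1 m2)) = S.
  rewrite sum_symE; under eq_bigr do rewrite sum_symE.
  rewrite pair_bigA /=; apply/esym.
  apply: (is_sum_finpart bij_window2 fS) => -[i1 i2] /=.
  set m1 := (i1%:Z - j%:Z); set m2 := (i2%:Z - j%:Z).
  have h := nnsum_gauss_shift (half e.1) (half e.2) m1 m2 d_gt0 a2 c2 D2 (quad_form2 s_sym).
  apply: eq_is_sum (is_sumZ _ (is_sum_nnsum h)) => z /=.
  rewrite [LHS]mulrC; congr (expR (- _) * _).
    rewrite /window2 /= -/m1 -/m2 /qform /a' /b' /c' /s1 /s2 !intrD !intrM -!pmulrn.
    by move: (@pi R) => p; field; rewrite gt_eqF.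
  rewrite -[RHS](cosD2pi_int _ (2 * (k1 * z.1 + k2 * z.2))); congr cos.
  rewrite /window2 /= -/m1 -/m2 /th /u1 /u2 !intrD !intrM !intrD !intrM -!pmulrn.
  by move: (@pi R) => p; field; rewrite gt_eqF.
have sqrtE : Num.sqrt (a' * c' - b' ^+ 2) = 2 * Num.sqrt D / d%:R.
  rewrite D'E.
  have -> : 4 * D / d%:R ^+ 2 = (2 / d%:R) ^+ 2 * D by field; rewrite gt_eqF.
  rewrite sqrtrM ?sqr_ge0// sqrtr_sqr ger0_norm ?divr_ge0 ?(ltW dR)//.
  by rewrite mulrAC.
have sD : 0 < Num.sqrt D by rewrite sqrtr_gt0.
suff : Num.sqrt (a' * c' - b' ^+ 2) * S = cos theta *
   \sum_(f : bool * bool) (-1) ^+ ((e.1 && f.1) (+) (e.2 && f.2)) *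
      gauss_shift (half f.1) (half f.2) d (2 *: invmx s) k1 k2.
  move=> <-; rewrite sqrtE detE; field; by rewrite !gt_eqF.
rewrite mulr_sumr; apply: (is_sum_finpart bij_parity1 gS) => -[f1 f2].
have dn : \det s != 0 by rewrite detE gt_eqF.
have a2V : 0 < 2 * (c / \det s) by rewrite detE mulr_gt0// divr_gt0.
have c2V : 0 < 2 * (a / \det s) by rewrite detE mulr_gt0// divr_gt0.
have D2V : 0 < 2 * (c / \det s) * (2 * (a / \det s)) - (2 * (- b / \det s)) ^+ 2.
  have -> : 2 * (c / \det s) * (2 * (a / \det s)) - (2 * (- b / \det s)) ^+ 2 =
     4 / \det s ^+ 2 * D by rewrite /D; field.
  by rewrite mulr_gt0// divr_gt0// exprn_gt0// detE.
have h := nnsum_gauss_shift (half f1) (half f2) k1 k2 d_gt0 a2V c2V D2V (quad_form2V s_sym s_pos).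
rewrite [X in is_sum _ X]mulrA; apply: eq_is_sum (is_sumZ _ (is_sum_nnsum h)) => z /=.
rewrite [LHS]mulrC; congr (expR (- _) * _).
  rewrite D'E detE /parity1 /= /qform /a' /b' /c' /u1 /u2 !halfE !intrD !intrM -!pmulrn.
  have Dn := gt_eqF D0; move: D Dn => D' Dn.
  by move: (@pi R) => p; field; rewrite Dn gt_eqF.
have sgn : cos theta * (-1) ^+ ((e.1 && f1) (+) (e.2 && f2)) =
    cos (theta + pi * (((e.1 && f1) + (e.2 && f2))%N)%:R).
  case: (e.1 && f1); case: (e.2 && f2) => /=.
  - by rewrite expr0 mulr1 mulr_natr cosD2pi.
  - by rewrite addn0 mulr1 cosDpi expr1 mulrN1.
  - by rewrite add0n mulr1 cosDpi expr1 mulrN1.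
  - by rewrite mulr0 addr0 expr0 mulr1.
(* For a dual point 2z + f the phase is pi d e (2z + f). With d = 2j + 1, all of it except pi e f is
   a multiple of 2 pi, and the integer given here counts these multiples. *)
rewrite sgn -[LHS](cosD2pi_int _ (e.1%:Z * k1 + e.2%:Z * k2 + d%:Z * (e.1%:Z * z.1 + e.2%:Z * z.2) +
  j%:Z * (e.1%:Z * f1%:Z + e.2%:Z * f2%:Z))).
congr cos; rewrite /th /parity1 /= /u1 /u2 /s1 /s2 !halfE.
have dRE : d%:R = 2 * j%:R + 1 :> R by rewrite dE natrD natrM.
rewrite !intrD !intrM !intrD !intrM -!pmulrn !natrD.
have -> : ((e.1 && f1 : nat)%:R : R) = (e.1 : nat)%:R * (f1 : nat)%:R.
  by rewrite -natrM mulnb.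
have -> : ((e.2 && f2 : nat)%:R : R) = (e.2 : nat)%:R * (f2 : nat)%:R.
  by rewrite -natrM mulnb.
have J0 : 2 * j%:R + 1 != 0 :> R by rewrite -dRE gt_eqF.
rewrite dRE; move: (@pi R) (j%:R : R) J0 => p J J0.
by field; rewrite J0.
Qed.

End Fixed.
End Wigner.

(** * The Wigner function *)

Local Open Scope complex_scope.

Section Assembly.
Context {R : realType}.
Implicit Types (s : 'M[R]_2) (theta : R) (d j : nat) (n k m : int).

Lemma sum_bool2 (F : bool * bool -> R) : \sum_(e : bool * bool) F e =
  F (false, false) + F (true, false) + F (false, true) + F (true, true).
Proof.
rewrite (eq_bigr (fun e => F (e.1, e.2))) => [|[] //].
rewrite -(pair_bigA _ (fun e f => F (e, f))) /= !big_bool /=; ring.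
Qed.

(** The free phase comes out as the factor cos theta: theta = 0 gives the real part of the Wigner
    function, and theta = -pi/2 shows that the imaginary part is zero. *)
Lemma wigner_phase d j s theta n1 n2 k1 k2 : d = (2 * j + 1)%N ->
  s \is symmetricmx -> posdef s ->
  (d%:R ^+ 2)^-1 * sum_sym j (fun m1 => sum_sym j (fun m2 =>
    cos (theta - 4 * pi / d%:R * (k1 * m1 + k2 * m2)%:~R) *
    (gauss d s (n1 - m1) (n2 - m2) * gauss d s (n1 + m1) (n2 + m2)))) =
  cos theta * \sum_(e : bool * bool) (1 / (2 * d%:R * Num.sqrt (\det s)) *
    gauss_shift (half e.1) (half e.2) d (2 *: s) n1 n2 *
    \sum_(f : bool * bool) (-1) ^+ ((e.1 && f.1) (+) (e.2 && f.2)) *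
      gauss_shift (half f.1) (half f.2) d (2 *: invmx s) k1 k2).
Proof.
move=> dE s_sym s_pos.
have dR : d%:R != 0 :> R by rewrite pnatr_eq0 dE addn1.
have sD : Num.sqrt (\det s) != 0.
  by rewrite gt_eqF// sqrtr_gt0 det2// posdef_det.
transitivity ((d%:R ^+ 2)^-1 * \sum_(e : bool * bool)
    gauss_shift (half e.1) (half e.2) d (2 *: s) n1 n2 *
    sum_sym j (fun m1 => sum_sym j (fun m2 =>
      cos (theta - 4 * pi / d%:R * (k1 * m1 + k2 * m2)%:~R) *
      gauss_shift (half e.1) (half e.2) d (2 *: s) m1 m2))).
  congr (_ * _); rewrite /sum_sym.
  under [RHS]eq_bigr do rewrite mulr_sumr.
  rewrite [RHS]exchange_big /=; apply: eq_bigr => i1 _.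
  under [RHS]eq_bigr do rewrite mulr_sumr.
  rewrite [RHS]exchange_big /=; apply: eq_bigr => i2 _.
  rewrite (gauss_mul s_sym s_pos dE) mulr_sumr; apply: eq_bigr => e _; ring.
rewrite !mulr_sumr; apply: eq_bigr => e _.
rewrite (gauss_fourier s_sym s_pos dE).
move: (\sum_f _) (gauss_shift _ _ _ _ _ _) (cos theta) => G g t.
by field; rewrite dR sD.
Qed.

Lemma sum_sym_complex j (f g : int -> R) :
  sum_sym j (fun m => f m +i* g m) = sum_sym j f +i* sum_sym j g.
Proof.
apply/eqP; rewrite eq_complex /sum_sym.
by rewrite !raddf_sum /= !eqxx.
Qed.

Lemma expi_mulC t (x y : R) : expi t * (x%:C)^* * y%:C =
  (cos t * (x * y)) +i* (cos (t - pi / 2) * (x * y)).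
Proof.
rewrite cosBpihalf; apply/eqP; rewrite eq_complex /expi /=.
by apply/andP; split; apply/eqP; ring.
Qed.

End Assembly.

Theorem theorem2 (R : realType) (d j : nat) (hd : d = (2 * j + 1)%N)
    (s : 'M[R]_2) (s_sym : s \is symmetricmx) (s_pos : posdef s)
    (n1 n2 k1 k2 : int) :
  wigner d j (fun m1 m2 => (gauss d s m1 m2)%:C) n1 n2 k1 k2 =
  (1 / (2 * d%:R * Num.sqrt (\det s)) * gauss d (2 *: s) n1 n2 *
     (gauss d (2 *: invmx s) k1 k2 + gauss_p0 d (2 *: invmx s) k1 k2
      + gauss_0p d (2 *: invmx s) k1 k2 + gauss_pp d (2 *: invmx s) k1 k2)
   + 1 / (2 * d%:R * Num.sqrt (\det s)) * gauss_p0 d (2 *: s) n1 n2 *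
     (gauss d (2 *: invmx s) k1 k2 - gauss_p0 d (2 *: invmx s) k1 k2
      + gauss_0p d (2 *: invmx s) k1 k2 - gauss_pp d (2 *: invmx s) k1 k2)
   + 1 / (2 * d%:R * Num.sqrt (\det s)) * gauss_0p d (2 *: s) n1 n2 *
     (gauss d (2 *: invmx s) k1 k2 + gauss_p0 d (2 *: invmx s) k1 k2
      - gauss_0p d (2 *: invmx s) k1 k2 - gauss_pp d (2 *: invmx s) k1 k2)
   + 1 / (2 * d%:R * Num.sqrt (\det s)) * gauss_pp d (2 *: s) n1 n2 *
     (gauss d (2 *: invmx s) k1 k2 - gauss_p0 d (2 *: invmx s) k1 k2
      - gauss_0p d (2 *: invmx s) k1 k2 + gauss_pp d (2 *: invmx s) k1 k2))%:C.
Proof.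
rewrite /wigner.
have -> : ((d%:R ^+ 2)^-1 : R[i]) = ((d%:R ^+ 2)^-1 : R)%:C.
  by rewrite fmorphV rmorphXn rmorph_nat.
have -> : sum_sym j (fun m1 => sum_sym j (fun m2 =>
    expi (- (4 * pi / d%:R) * (k1 * m1 + k2 * m2)%:~R) *
    (((gauss d s (n1 - m1) (n2 - m2))%:C)^* : R[i]) * (gauss d s (n1 + m1) (n2 + m2))%:C)) =
  sum_sym j (fun m1 => sum_sym j (fun m2 =>
    cos (0 - 4 * pi / d%:R * (k1 * m1 + k2 * m2)%:~R) *
    (gauss d s (n1 - m1) (n2 - m2) * gauss d s (n1 + m1) (n2 + m2)))) +i*
  sum_sym j (fun m1 => sum_sym j (fun m2 =>
    cos (- (pi / 2) - 4 * pi / d%:R * (k1 * m1 + k2 * m2)%:~R) *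
    (gauss d s (n1 - m1) (n2 - m2) * gauss d s (n1 + m1) (n2 + m2)))).
  rewrite -sum_sym_complex; congr (sum_sym j _); apply/funext => m1.
  rewrite -sum_sym_complex; congr (sum_sym j _); apply/funext => m2.
  rewrite expi_mulC sub0r mulNr; congr (_ +i* (cos _ * _)).
  by rewrite addrC.
apply/eqP; rewrite eq_complex; apply/andP; split; apply/eqP => /=; last first.
  rewrite mul0r addr0 (wigner_phase (- (pi / 2)))//.
  by rewrite cosN cos_pihalf mul0r.
rewrite mul0r subr0 (wigner_phase 0)// cos0 mul1r !sum_bool2 /=.
rewrite /gauss /gauss_p0 /gauss_0p /gauss_pp /half ?expr0 ?expr1.
move: (1 / (2 * d%:R * Num.sqrt (\det s))) => w.
move: (gauss_shift 0 0 d (2 *: s) n1 n2) (gauss_shift 2^-1 0 d (2 *: s) n1 n2)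
  (gauss_shift 0 2^-1 d (2 *: s) n1 n2) (gauss_shift 2^-1 2^-1 d (2 *: s) n1 n2)
  (gauss_shift 0 0 d (2 *: invmx s) k1 k2) (gauss_shift 2^-1 0 d (2 *: invmx s) k1 k2)
  (gauss_shift 0 2^-1 d (2 *: invmx s) k1 k2)
  (gauss_shift 2^-1 2^-1 d (2 *: invmx s) k1 k2) => x1 x2 x3 x4 y1 y2 y3 y4.
ring.
Qed.
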